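(* Let $\Gamma_g$ be the fundamental group of a closed orientable surface of genus $g\ge2$, with a fixed finite generating set, and let $k\ge1$. There is a constant $C$ such that for every element $w\in\Gamma_g$ of length $n\ge2$ at the $k$-th level in the lower central series of $\Gamma_g$ there is a normal subgroup $H(w)$ of $\Gamma_g$ of index at most $C(\log n)^{k(k+1)/2}$ which does not contain $w$.
   Context: The lower central series is $\gamma_1=\Gamma_g$, $\gamma_{j+1}=[\Gamma_g,\gamma_j]$; an element $w$ is at the $k$-th level if $w\in\gamma_k\setminus\gamma_{k+1}$ (so level $1$ means not in the commutator subgroup). Length is word length in the fixed generating set. The constant $C$ may depend on $k$ and $\Gamma_g$ but not on $w$ or $n$. *)

(* Defs.v *)
From HB Require Import structures.
From mathcomp Require Import all_boot all_order all_algebra.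
From mathcomp Require Import generic_quotient.
From mathcomp Require Import boolp classical_sets cardinality reals exp.

Set Implicit Arguments.
Unset Strict Implicit.
Unset Printing Implicit Defensive.

Local Open Scope classical_set_scope.
Local Open Scope quotient_scope.
Local Open Scope card_scope.
Local Open Scope group_scope.

(* Words in the letters x and x^-1, for x in X; the pair (x, false) stands for
   x and (x, true) for its inverse. *)
Definition word (X : Type) := seq (X * bool).

Section Presentation.
Variables (X : choiceType) (Rel : set (word X)).
Implicit Types u v w r : word X.

Inductive pres_eq : word X -> word X -> Prop :=
| pres_refl u : pres_eq u u
| pres_sym u v : pres_eq u v -> pres_eq v u
| pres_trans u v w : pres_eq u v -> pres_eq v w -> pres_eq u w
| pres_cancel u x b v : pres_eq (u ++ (x, b) :: (x, ~~ b) :: v) (u ++ v)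
| pres_relator u r v : Rel r -> pres_eq (u ++ r ++ v) (u ++ v).

Definition pres_eqb : rel (word X) := fun u v => `[< pres_eq u v >].

Lemma pres_eqb_refl : reflexive pres_eqb.
Proof. by move=> u; apply/asboolP/pres_refl. Qed.

Lemma pres_eqb_sym : symmetric pres_eqb.
Proof. by move=> u v; apply/asboolP/asboolP; apply: pres_sym. Qed.

Lemma pres_eqb_trans : transitive pres_eqb.
Proof.
by move=> v u w /asboolP uv /asboolP vw; apply/asboolP/(pres_trans uv vw).
Qed.

Canonical pres_equiv :=
  EquivRel pres_eqb pres_eqb_refl pres_eqb_sym pres_eqb_trans.

(* The group < X | Rel >. *)
Definition presented := {eq_quot pres_equiv}.

HB.instance Definition _ := Choice.on presented.

Definition winv w : word X := rev [seq (l.1, ~~ l.2) | l <- w].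

Lemma pres_piP u v : \pi_presented u = \pi_presented v <-> pres_eq u v.
Proof.
split=> [/eqP|uv]; first by rewrite eqmodE => /asboolP.
by apply/eqP; rewrite eqmodE; apply/asboolP.
Qed.

Lemma pres_repr w : pres_eq (repr (\pi_presented w)) w.
Proof. by apply/pres_piP; rewrite reprK. Qed.

Lemma pres_eq_cat u u' v v' :
  pres_eq u u' -> pres_eq v v' -> pres_eq (u ++ v) (u' ++ v').
Proof.
move=> uu' vv'; apply: (@pres_trans _ (u' ++ v)).
  elim: uu' => {u u' vv' v'} [u|u u' _|u u1 u2 _ + _|u x b w|u r w Rr].
  - exact: pres_refl.
  - exact: pres_sym.
  - exact: pres_trans.
  - by rewrite -!catA /=; exact: pres_cancel.
  - by rewrite -!catA; exact: pres_relator.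
elim: vv' => {u uu' v v'} [v|v v' _|v v1 v2 _ + _|v x b w|v r w Rr].
- exact: pres_refl.
- exact: pres_sym.
- exact: pres_trans.
- by rewrite !catA; exact: pres_cancel.
- by rewrite !(catA u'); exact: pres_relator.
Qed.

Lemma winvK : involutive winv.
Proof.
move=> w; rewrite /winv map_rev revK -map_comp -[RHS]map_id.
by apply: eq_map => -[x b] /=; rewrite negbK.
Qed.

Lemma pres_catV w : pres_eq (w ++ winv w) [::].
Proof.
elim: w => [|[x b] w IH]; first exact: pres_refl.
rewrite /winv /= rev_cons -cats1 catA.
apply: pres_trans (pres_cancel [::] x b [::]) => /=.
apply: (@pres_eq_cat [:: (x, b)] _ _ _ (pres_refl _)).
exact: (pres_eq_cat IH (pres_refl _)).
Qed.

Lemma pres_Vcat w : pres_eq (winv w ++ w) [::].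
Proof. by rewrite -{2}(winvK w); exact: pres_catV. Qed.

Lemma pres_eq_inv u v : pres_eq u v -> pres_eq (winv u) (winv v).
Proof.
move=> uv; have := pres_eq_cat (pres_refl (winv u)) (pres_sym (pres_catV v)).
rewrite cats0 => /pres_trans; apply.
apply: (@pres_trans _ ((winv u ++ u) ++ winv v)).
  rewrite catA; apply: pres_eq_cat (pres_refl _).
  exact: pres_eq_cat (pres_refl _) (pres_sym uv).
exact: pres_eq_cat (pres_Vcat u) (pres_refl _).
Qed.

Definition pres_one : presented := \pi_presented [::].
Definition pres_mul (x y : presented) : presented := \pi_presented (repr x ++ repr y).
Definition pres_inv (x : presented) : presented := \pi_presented (winv (repr x)).

Lemma pres_mulE u v :
  pres_mul (\pi_presented u) (\pi_presented v) = \pi_presented (u ++ v).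
Proof. by apply/pres_piP/pres_eq_cat; exact: pres_repr. Qed.

Lemma pres_invE u : pres_inv (\pi_presented u) = \pi_presented (winv u).
Proof. by apply/pres_piP/pres_eq_inv/pres_repr. Qed.

Lemma pres_elim (x : presented) : exists u, x = \pi_presented u.
Proof. by exists (repr x); rewrite reprK. Qed.

Lemma pres_mulA : associative pres_mul.
Proof.
move=> x y z; have [u ->] := pres_elim x; have [v ->] := pres_elim y.
have [w ->] := pres_elim z.
by rewrite !pres_mulE catA.
Qed.

Lemma pres_mul1 : left_id pres_one pres_mul.
Proof. by move=> x; have [u ->] := pres_elim x; rewrite pres_mulE. Qed.

Lemma pres_mulr1 : right_id pres_one pres_mul.
Proof. by move=> x; have [u ->] := pres_elim x; rewrite pres_mulE cats0. Qed.

Lemma pres_mulV : left_inverse pres_one pres_inv pres_mul.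
Proof.
move=> x; have [u ->] := pres_elim x.
by rewrite pres_invE pres_mulE; exact/pres_piP/pres_Vcat.
Qed.

Lemma pres_mulrV : right_inverse pres_one pres_inv pres_mul.
Proof.
move=> x; have [u ->] := pres_elim x.
by rewrite pres_invE pres_mulE; exact/pres_piP/pres_catV.
Qed.

HB.instance Definition _ := isGroup.Build presented
  pres_mulA pres_mul1 pres_mulr1 pres_mulV pres_mulrV.

Definition pres_gen (x : X) : presented := \pi_presented [:: (x, false)].

End Presentation.

Definition word_eval (X : Type) (G : groupType) (f : X -> G) (w : word X) : G :=
  \prod_(l <- w) (if l.2 then (f l.1)^-1 else f l.1).

Section UniversalProperty.
Variables (X : choiceType) (Rel : set (word X)).

Lemma word_eval_pres_gen w : word_eval (pres_gen Rel) w = \pi_(presented Rel) w.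
Proof.
rewrite /word_eval; elim: w => [|[x b] w IH]; first by rewrite big_nil.
rewrite big_cons IH /= -[(x, b) :: w]/([:: (x, b)] ++ w) -pres_mulE.
by case: b => //; congr (_ * _); exact: pres_invE.
Qed.

Lemma word_eval_relator r : Rel r -> word_eval (pres_gen Rel) r = 1.
Proof.
move=> Rr; rewrite word_eval_pres_gen; apply/pres_piP.
by rewrite -[r]cats0; exact: (pres_relator [::] [::] Rr).
Qed.

Lemma presented_universal (G : groupType) (f : X -> G) :
  (forall r, Rel r -> word_eval f r = 1) ->
  exists2 h : presented Rel -> G, {morph h : x y / x * y} &
    forall x, h (pres_gen Rel x) = f x.
Proof.
move=> fR.
have evM u v : word_eval f (u ++ v) = word_eval f u * word_eval f v.
  by rewrite /word_eval big_cat.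
have ev_eq u v : pres_eq Rel u v -> word_eval f u = word_eval f v.
  elim=> {u v} [//|//|u v w _ -> _ -> //|u x b v|u r v Rr].
    rewrite !evM; congr (_ * _); rewrite /word_eval !big_cons /=.
    by case: b; rewrite /= mulgA ?mulVg ?mulgV mul1g.
  by rewrite !evM (fR r Rr) mul1g.
exists (fun x => word_eval f (repr x)) => [|x].
  move=> x y; have [u ->] := pres_elim x; have [v ->] := pres_elim y.
  rewrite [X in repr X]pres_mulE.
  by rewrite !(ev_eq _ _ (pres_repr _ _)) evM.
by rewrite (ev_eq _ _ (pres_repr _ _)) /word_eval big_seq1.
Qed.

End UniversalProperty.

(* The relator [a_1, b_1] ... [a_g, b_g], where a_i is the letter inl i and b_i
   the letter inr i, and [a, b] = a b a^-1 b^-1. *)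
Definition surface_relator (g : nat) : word ('I_g + 'I_g)%type :=
  flatten [seq [:: (inl i, false); (inr i, false); (inl i, true); (inr i, true)]
          | i <- enum 'I_g].

(* The fundamental group of the closed orientable surface of genus g (the
   4g-gon with its sides identified according to the relator), by its
   standard presentation. *)
Definition surface_group (g : nat) : groupType :=
  presented [set surface_relator g].

Section GroupNotions.
Variable G : groupType.
Implicit Types (H A : set G) (S s : seq G) (x : G).

Definition is_word_in S s : Prop :=
  forall y, y \in s -> y \in S \/ y^-1 \in S.

Definition generating S : Prop :=
  forall x, exists2 s, is_word_in S s & x = \prod_(y <- s) y.

Definition has_word_length S x (n : nat) : Prop :=
  (exists s, [/\ is_word_in S s, x = \prod_(y <- s) y & size s = n]) /\
  (forall s, is_word_in S s -> x = \prod_(y <- s) y -> (n <= size s)%N).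

Definition is_subgroup H : Prop := group_closed [in H].

Definition is_normal_subgroup H : Prop :=
  is_subgroup H /\ forall x y, H x -> H (x ^ y).

Definition subgroup_generated A : set G := smallest is_subgroup A.

(* 1-based: lower_central 1 is G; the value at 0 is also G and is irrelevant. *)
Definition lower_central (j : nat) : set G :=
  iter j.-1
    (fun A => subgroup_generated [set [~ x, y] | x in [set: G] & y in A])
    [set: G].

Definition at_level (k : nat) x : Prop :=
  lower_central k x /\ ~ lower_central k.+1 x.

Definition lcosets H : set (set G) :=
  [set [set x * h | h in H] | x in [set: G]].

Definition has_index H (m : nat) : Prop := lcosets H #= `I_m.

End GroupNotions.

(* Main.v *)
(** The graded pieces of the lower central series are compared with Lie
    polynomials in the 2g generators.  Lazard elimination (first of the letter
    a_1, using [a_1,b_1] = - sum_{i>1} [a_i,b_i], then of the letters of least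
    weight one after the other) produces operators X_i, with
    sum_i [X_{a_i},X_{b_i}] = 0, such that a Lie polynomial of weight k
    vanishing at the X_i already vanishes in gamma_k / gamma_{k+1}.  This plays
    the role of the torsion-freeness of gamma_k / gamma_{k+1}.

    Hence an element w of level k is detected by a functional on words of
    length k killing the ideal generated by omega = sum_i [a_i,b_i].  For
    g >= 2 such functionals are spanned by the chains phi_1 (x) ... (x) phi_k
    whose consecutive terms are orthogonal for the symplectic form, and a chain
    without zero term is the superdiagonal of a representation of the surface
    group by (k+1) x (k+1) rational unitriangular matrices, which becomes
    integral after conjugation by a diagonal matrix.  Finitely many chains
    suffice.

    So the corner entry of one of finitely many integral unitriangular
    representations does not vanish at w; it is O(n^k), hence not divisible by
    some m = O(log n), and the kernel of the reduction mod m has index at most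
    m^(k(k+1)/2). *)
Require Import Defs.
From mathcomp Require Import all_boot all_order all_algebra.
From mathcomp Require Import boolp classical_sets functions cardinality reals exp.
From mathcomp Require Import zify ring lra.
Import Order.TTheory GRing.Theory Num.Theory.

Set Implicit Arguments.
Unset Strict Implicit.
Unset Printing Implicit Defensive.

(** [lie_pair] carries a group element and an operator along the same Lie polynomial. It is a
    relation, so neither a free Lie algebra nor a basis of it is ever constructed. The passage from
    operators to matrices goes through words: applying the letters of a word to a vector and reading
    one coordinate is a functional on words, and a single list of signed words attached to w
    computes both this functional and the corner entry of every chain representation at w. The
    corner entry is O(n^k) because a product of n unitriangular matrices reaches the corner, at
    distance k from the diagonal, with at most k off-diagonal factors. That m = O(log n) suffices
    rests on lcm(1, ..., N+1) >= 2^N: a nonzero integer of size O(n^k) cannot be divisible by all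
    integers up to a large multiple of log n. The exponent k(k+1)/2 counts the entries above the
    diagonal, each known modulo m. *)

(** * Common multiples of 1, ..., n+1 are exponentially large *)

Section Arithmetic.
Local Open Scope nat_scope.

(* Leibniz's harmonic triangle: with L n k = (n+1) C(n,k) one has
   1/L (n+1) (k+1) = 1/L n k - 1/L (n+1) k. *)
Lemma leibniz_triangle_dvdn (N n k : nat) : k <= n ->
  (forall m, 0 < m <= n.+1 -> m %| N) -> n.+1 * 'C(n, k) %| N.
Proof.
elim: k n => [|k IH] n kn dN; first by rewrite bin0 muln1 dN ?ltnS ?leqnn.
case: n kn dN => // n kn dN.
have /dvdnP[a Ea] := IH n.+1 (ltnW kn) dN.
have dN' m : 0 < m <= n.+1 -> m %| N.
  by case/andP=> m0 mn; rewrite dN ?m0 ?(leq_trans mn).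
have /dvdnP[b Eb] := IH n kn dN'.
(* The identity of the triangle multiplied by N: the quotient of N by L (n+1) (k+1) is its quotient
   by L n k minus its quotient by L (n+1) k. *)
apply/dvdnP; exists (b - a).
have Cpos : 0 < 'C(n.+1, k) by rewrite bin_gt0 ltnW.
have e1 : n.+1 * 'C(n, k) = k.+1 * 'C(n.+1, k.+1) by rewrite mul_bin_diag.
have e2 : k.+1 * 'C(n.+1, k.+1) = (n.+1 - k) * 'C(n.+1, k) by rewrite mul_bin_left.
move: Ea Eb e2; rewrite e1.
set c := 'C(n.+1, k); set c' := 'C(n.+1, k.+1) => Ea Eb e2.
apply/eqP; rewrite -(eqn_pmul2r Cpos) -/c mulnBl mulnBl; apply/eqP.
have -> : a * (n.+2 * c') * c = N * c' by rewrite Ea; ring.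
suff -> : b * (n.+2 * c') * c = N * c + N * c' by rewrite addnK.
have -> : n.+2 = k.+1 + (n.+1 - k) by lia.
rewrite mulnDl mulnDr mulnDl Eb; congr (_ + _).
by rewrite e2; ring.
Qed.

(** (n+1) 2^n is the sum of the n+1 numbers (n+1) C(n,i); each divides N, hence is at most N. *)
Lemma exp2_leq_of_dvdn (N n : nat) : 0 < N ->
  (forall m, 0 < m <= n.+1 -> m %| N) -> 2 ^ n <= N.
Proof.
move=> N0 dN; rewrite -(@leq_pmul2l n.+1) // -[2]/(1 + 1) expnDn big_distrr /=.
have -> : n.+1 * N = \sum_(i < n.+1) N by rewrite sum_nat_const card_ord.
apply: leq_sum => i _.
rewrite !exp1n !muln1; apply: dvdn_leq => //.
by apply: leibniz_triangle_dvdn => //; rewrite -ltnS.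
Qed.
End Arithmetic.

(** * Commutator calculus in a strongly central filtration *)

Section Subgroups.
Local Open Scope classical_set_scope.
Local Open Scope group_scope.
Variable G : groupType.
Implicit Types (H A : set G) (x y z : G).

Lemma is_subgroupP H :
  is_subgroup H <-> [/\ H 1, forall x y, H x -> H y -> H (x * y)
                     & forall x, H x -> H x^-1].
Proof.
split=> [gH|[H1 HM HV]].
  split; first by have := gH.1; rewrite inE.
    by move=> x y Hx Hy; have := group_closedM gH; move/(_ x y); rewrite !inE; apply.
  by move=> x Hx; have := group_closedV gH; move/(_ x); rewrite !inE; apply.
split; first by rewrite inE.
by move=> x y; rewrite !inE => Hx Hy; apply: HM => //; exact: HV.
Qed.

Lemma Hall_Witt x y z :
  [~ x, y^-1, z] ^ y * ([~ y, z^-1, x] ^ z * [~ z, x^-1, y] ^ x) = 1.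
Proof.
rewrite /commg /conjg !invgM !invgK !mulgA.
by do !rewrite ?(mulgK, mulgVK, mulgV, mulVg, mul1g, mulg1).
Qed.

End Subgroups.

Section NSeries.
Local Open Scope classical_set_scope.
Local Open Scope group_scope.
Variable G : groupType.
Implicit Types (x y z u v w : G).

(** Lazard's N-series. Elimination only uses these axioms, which the truncated lower central series
    below also satisfies. *)
Definition N_series (D : nat -> set G) : Prop :=
  [/\ D 1%N = setT, forall j, is_subgroup (D j), forall j, D j.+1 `<=` D j
    & forall i j x y, D i x -> D j y -> D (i + j)%N [~ x, y]].

Variable D : nat -> set G.
Hypothesis D_N : N_series D.

Lemma N_seriesT x : D 1%N x. Proof. by case: D_N => ->. Qed.

Lemma N_series0 x : D 0 x. Proof. by case: D_N => D1 _ DS _; apply: DS; rewrite D1. Qed.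

Lemma N_series1 j : D j 1.
Proof. by case: D_N => _ /(_ j)/is_subgroupP[]. Qed.

Lemma N_seriesM j x y : D j x -> D j y -> D j (x * y).
Proof. by case: D_N => _ /(_ j)/is_subgroupP[_ + _] _ _; apply. Qed.

Lemma N_seriesV j x : D j x -> D j x^-1.
Proof. by case: D_N => _ /(_ j)/is_subgroupP[_ _ +] _ _; apply. Qed.

Lemma N_seriesR i j x y : D i x -> D j y -> D (i + j)%N [~ x, y].
Proof. by case: D_N => _ _ _; apply. Qed.

Lemma N_series_le i j x : (i <= j)%N -> D j x -> D i x.
Proof.
case: D_N => _ _ DS _ /subnK <-; elim: (j - i)%N => // n IH.
by rewrite addSn => /DS.
Qed.

Lemma N_seriesJ j x y : D j x -> D j (x ^ y).
Proof.
move=> Dx; have -> : x ^ y = x * [~ x, y] by rewrite /commg mulgA mulgV mul1g.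
(* Normality is the commutator axiom in weight j + 0, as [D 0] is the whole group. *)
by apply: N_seriesM => //; rewrite -[j]addn0; apply: N_seriesR (N_series0 y).
Qed.

Lemma N_seriesJr j x y : D j (x ^ y) -> D j x.
Proof. by move=> /(N_seriesJ y^-1); rewrite conjgK. Qed.

Definition Ncong n x y : Prop := D n (x^-1 * y).

Lemma Ncong_refl n x : Ncong n x x.
Proof. by rewrite /Ncong mulVg; exact: N_series1. Qed.

Lemma Ncong_sym n x y : Ncong n x y -> Ncong n y x.
Proof. by move/N_seriesV; rewrite /Ncong invgM invgK. Qed.

Lemma Ncong_trans n y x z : Ncong n x y -> Ncong n y z -> Ncong n x z.
Proof.
move=> xy yz; have := N_seriesM xy yz.
by rewrite /Ncong mulgA -(mulgA _ y) mulgV mulg1.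
Qed.

Lemma NcongM n x x' y y' : Ncong n x x' -> Ncong n y y' -> Ncong n (x * y) (x' * y').
Proof.
move=> xx yy; rewrite /Ncong.
have -> : (x * y)^-1 * (x' * y') = (x^-1 * x') ^ y * (y^-1 * y').
  by rewrite /conjg invgM !mulgA; do !rewrite ?(mulgK, mulgVK).
by apply: N_seriesM => //; exact: N_seriesJ.
Qed.

Lemma NcongV n x y : Ncong n x y -> Ncong n x^-1 y^-1.
Proof.
move=> /N_seriesV xy; apply: (@N_seriesJr n _ x).
by rewrite /conjg; move: xy; rewrite !invgK invgM invgK !mulgA mulVg mul1g.
Qed.

Lemma Ncong1 n x : Ncong n 1 x <-> D n x.
Proof. by rewrite /Ncong invg1 mul1g. Qed.

Lemma Ncong_le n m x y : (m <= n)%N -> Ncong n x y -> Ncong m x y.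
Proof. exact: N_series_le. Qed.

Lemma Ncong_memr n x y : Ncong n x y -> D n x -> D n y.
Proof.
move=> xy Dx; have := N_seriesM Dx xy.
by rewrite mulgA mulgV mul1g.
Qed.

Lemma NcongC i j n x y : (n <= i + j)%N -> D i x -> D j y -> Ncong n (x * y) (y * x).
Proof.
move=> le Dx Dy; apply: Ncong_le le _; rewrite /Ncong.
have -> : (x * y)^-1 * (y * x) = [~ y, x].
  by rewrite /commg /conjg invgM !mulgA.
by rewrite addnC; exact: N_seriesR.
Qed.

Lemma NcongCS n x y : D n x -> Ncong n.+1 (x * y) (y * x).
Proof. by move=> Dx; apply: NcongC Dx (N_seriesT y); rewrite addn1. Qed.

Lemma NcongJ n x y : D n x -> Ncong n.+1 (x ^ y) x.
Proof.
move=> Dx; apply: Ncong_sym; rewrite /Ncong -commgEl.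
by rewrite -addn1; exact: N_seriesR Dx (N_seriesT y).
Qed.

Lemma NcongRMl i j x x' y : D i x -> D j y ->
  Ncong (i + j).+1 [~ x * x', y] ([~ x, y] * [~ x', y]).
Proof.
move=> Dx Dy; have -> : [~ x * x', y] = [~ x, y] ^ x' * [~ x', y].
  rewrite /commg /conjg !invgM !mulgA.
  by do !rewrite ?(mulgK, mulgVK, mulgV, mulVg, mul1g, mulg1).
by apply: NcongM (Ncong_refl _ _); apply: NcongJ; exact: N_seriesR.
Qed.

Lemma NcongRMr i j x y y' : D i x -> D j y ->
  Ncong (i + j).+1 [~ x, y * y'] ([~ x, y] * [~ x, y']).
Proof.
move=> Dx Dy; have -> : [~ x, y * y'] = [~ x, y'] * [~ x, y] ^ y'.
  rewrite /commg /conjg !invgM !mulgA.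
  by do !rewrite ?(mulgK, mulgVK, mulgV, mulVg, mul1g, mulg1).
have Dxy := N_seriesR Dx Dy.
apply: (Ncong_trans (NcongM (Ncong_refl _ _) (NcongJ _ Dxy))).
by apply: Ncong_sym; exact: NcongCS.
Qed.

Lemma NcongR i j x x' y y' : D i x -> D j y ->
  Ncong i.+1 x x' -> Ncong j.+1 y y' -> Ncong (i + j).+1 [~ x, y] [~ x', y'].
Proof.
move=> Dx Dy xx' yy'.
have -> : x' = x * (x^-1 * x') by rewrite mulgA mulgV mul1g.
have -> : y' = y * (y^-1 * y') by rewrite mulgA mulgV mul1g.
have Dx' := Ncong_memr (Ncong_le (leqnSn _) xx') Dx.
apply: Ncong_sym; apply: Ncong_trans; first apply: (NcongRMr _ (i := i)) => //.
  by rewrite mulgA mulgV mul1g.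
rewrite -[X in Ncong _ _ X]mulg1; apply: NcongM.
  apply: Ncong_trans; first exact: NcongRMl.
  rewrite -[X in Ncong _ _ X]mulg1; apply: NcongM; first exact: Ncong_refl.
  by apply/Ncong_sym/Ncong1; rewrite -addSn; exact: N_seriesR.
apply/Ncong_sym/Ncong1; rewrite -addnS; apply: N_seriesR => //.
by rewrite mulgA mulgV mul1g.
Qed.

Lemma Ncong_eqV n x y : Ncong n (x * y) 1 -> Ncong n y x^-1.
Proof.
move=> /(NcongM (Ncong_refl n x^-1)).
by rewrite mulgA mulVg mul1g mulg1.
Qed.

Lemma NcongRVl i j x y : D i x -> D j y ->
  Ncong (i + j).+1 [~ x^-1, y] [~ x, y]^-1.
Proof.
move=> Dx Dy; apply: Ncong_eqV; apply: Ncong_sym.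
by have := NcongRMl x^-1 Dx Dy; rewrite mulgV comm1g.
Qed.

Lemma NcongRVr i j x y : D i x -> D j y ->
  Ncong (i + j).+1 [~ x, y^-1] [~ x, y]^-1.
Proof.
move=> Dx Dy; apply: Ncong_eqV; apply: Ncong_sym.
by have := NcongRMr y^-1 Dx Dy; rewrite mulgV commg1.
Qed.

(** Read off the Hall-Witt identity: up to one weight more, conjugations disappear and inverses
    become signs. *)
Lemma Ncong_Jacobi i j l x y z : D i x -> D j y -> D l z ->
  Ncong (i + j + l).+1 [~ x, [~ y, z]] ([~ [~ x, y], z] * [~ y, [~ x, z]]).
Proof.
move=> Dx Dy Dz.
have term a b c u v t : (a + b + c = i + j + l)%N -> D a u -> D b v -> D c t ->
    Ncong (i + j + l).+1 ([~ u, v^-1, t] ^ v) [~ [~ u, v], t]^-1.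
  move=> <- Du Dv Dt.
  have Duv := N_seriesR Du Dv; have Duv' := N_seriesR Du (N_seriesV Dv).
  apply: Ncong_trans; first by apply: NcongJ; exact: N_seriesR.
  apply: (Ncong_trans _ (NcongRVl Duv Dt)).
  by apply: NcongR => //; [exact: NcongRVr | exact: Ncong_refl].
have t1 := term _ _ _ x y z erefl Dx Dy Dz.
have t2 : Ncong (i + j + l).+1 ([~ y, z^-1, x] ^ z) [~ x, [~ y, z]].
  by rewrite -(invgR _ x); apply: (term j l i) => //; rewrite addnC addnA.
have t3 : Ncong (i + j + l).+1 ([~ z, x^-1, y] ^ x) [~ y, [~ x, z]]^-1.
  have Dzx := N_seriesR Dz Dx; rewrite -(invgR z x).
  apply: (Ncong_trans (term l i j _ _ _ _ Dz Dx Dy)); first by rewrite -addnA addnC.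
  apply: NcongV; rewrite -(invgR _ y).
  have -> : (i + j + l = l + i + j)%N by lia.
  by apply: Ncong_sym; have := NcongV (NcongRVl Dzx Dy); rewrite invgK.
have := NcongM t1 (NcongM t2 t3); rewrite Hall_Witt => /Ncong_sym H.
move: H; move: [~ [~ x, y], z] [~ x, [~ y, z]] [~ y, [~ x, z]] => a b c H.
have := NcongM (NcongM (Ncong_refl _ a) H) (Ncong_refl _ c).
by rewrite mulg1 !mulgA mulgV mul1g mulgVK.
Qed.

End NSeries.

(** * The lower central series is an N-series *)

Section LowerCentral.
Local Open Scope classical_set_scope.
Local Open Scope group_scope.
Variable G : groupType.
Implicit Types (x y z u v w : G).
Local Notation gam := (@lower_central G).

Lemma subgroup_generated_sub (A : set G) : A `<=` subgroup_generated A.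
Proof. exact: sub_gen_smallest. Qed.

Lemma subgroup_generated_ind (A H : set G) :
  is_subgroup H -> A `<=` H -> subgroup_generated A `<=` H.
Proof. by move=> sH AH; exact: smallest_sub. Qed.

Lemma subgroup_generated_subgroup (A : set G) : is_subgroup (subgroup_generated A).
Proof.
apply/is_subgroupP; split=> [H [/is_subgroupP[] //]|x y Ax Ay H HA|x Ax H HA].
  have [/is_subgroupP[_ HM _] _] := HA.
  by apply: HM; [exact: Ax | exact: Ay].
by have [/is_subgroupP[_ _ HV] _] := HA; apply: HV; exact: Ax.
Qed.

Lemma lower_centralS j : (0 < j)%N ->
  gam j.+1 = subgroup_generated [set [~ x, y] | x in [set: G] & y in gam j].
Proof. by case: j. Qed.

Lemma lower_central_subgroup j : is_subgroup (gam j).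
Proof.
case: j => [|[|j]]; first by apply/is_subgroupP.
  by apply/is_subgroupP.
by rewrite lower_centralS //; exact: subgroup_generated_subgroup.
Qed.

Lemma lower_central1 j : gam j 1.
Proof. by have /is_subgroupP[] := lower_central_subgroup j. Qed.

Lemma lower_centralM j x y : gam j x -> gam j y -> gam j (x * y).
Proof. by have /is_subgroupP[_ + _] := lower_central_subgroup j; apply. Qed.

Lemma lower_centralV j x : gam j x -> gam j x^-1.
Proof. by have /is_subgroupP[_ _] := lower_central_subgroup j; apply. Qed.

Lemma lower_centralR1 j x y : (0 < j)%N -> gam j y -> gam j.+1 [~ x, y].
Proof.
by move=> j0 jy; rewrite lower_centralS //; apply: subgroup_generated_sub; exists x => //; exists y.
Qed.

(** The two halves support each other: a generator [u,v] is a conjugate of v^-1 times v, so descent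
    needs normality; and x^y = x [y,x]^-1, so normality needs descent one step earlier. *)
Lemma lower_central_desc j :
  (forall x, gam j.+1 x -> gam j x) /\ (forall x y, gam j x -> gam j (x ^ y)).
Proof.
elim: j => [|j [_ nj]] //.
have nj' x y : gam j.+1 x -> gam j.+1 (x ^ y).
  case: j nj => [//|j] nj jx.
  have -> : x ^ y = x * [~ y, x]^-1 by rewrite invgR /commg mulgA mulgV mul1g.
  apply: lower_centralM => //; apply/lower_centralV/lower_centralR1 => //.
  move: x {jx} (jx) => x; rewrite lower_centralS //.
  apply: subgroup_generated_ind; first exact: lower_central_subgroup.
  move=> _ [u _ [v jv <-]]; rewrite commgEr; apply: lower_centralM => //.
  by apply: nj; exact: lower_centralV.
split=> // x; rewrite lower_centralS //.
apply: subgroup_generated_ind; first exact: lower_central_subgroup.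
move=> _ [u _ [v jv <-]]; rewrite commgEr; apply: lower_centralM => //.
by apply: nj'; exact: lower_centralV.
Qed.

Lemma lower_centralJ j x y : gam j x -> gam j (x ^ y).
Proof. by have [_] := lower_central_desc j; apply. Qed.

Lemma lower_central_le i j x : (i <= j)%N -> gam j x -> gam i x.
Proof.
move=> /subnK <-; elim: (j - i)%N => // n IH.
by rewrite addSn => /(lower_central_desc _).1.
Qed.

Lemma lower_centralRC j x y : gam j [~ x, y] -> gam j [~ y, x].
Proof. by move/lower_centralV; rewrite invgR. Qed.

(** The three subgroups argument, by induction on i for all j: on a generator [g,u], the Hall-Witt
    identity trades [[g,u],y] for two commutators in which u, of smaller weight, is the entry used
    by the induction. *)
Lemma lower_centralR i j x y : gam i x -> gam j y -> gam (i + j) [~ x, y].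
Proof.
have conjE k u v : gam k (u ^ v) -> gam k u.
  by move=> /lower_centralJ-/(_ v^-1); rewrite conjgK.
have R0 k u v : gam k u -> gam k [~ v, u].
  move=> ku; rewrite commgEr; apply: lower_centralM => //.
  exact/lower_centralJ/lower_centralV.
elim: i j x y => [|[|i] IH] j x y; first by move=> _; exact: R0.
  case: j => [|j] _ jy; first exact: lower_centralRC.
  by rewrite add1n; exact: lower_centralR1.
move=> + jy; case: j jy => [|j] jy ix.
  by rewrite addn0; apply/lower_centralRC/R0.
move: x ix; rewrite lower_centralS //.
apply: (@subgroup_generated_ind _ [set x | gam (i.+2 + j.+1) [~ x, y]]).
  apply/is_subgroupP; split=> [|u v /= Hu Hv|u /= Hu].
  - by rewrite /= comm1g; exact: lower_central1.
  - have -> : [~ u * v, y] = [~ u, y] ^ v * [~ v, y].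
      rewrite /commg /conjg !invgM !mulgA.
      by do !rewrite ?(mulgK, mulgVK, mulgV, mulVg, mul1g, mulg1).
    by apply: lower_centralM => //; exact: lower_centralJ.
  - apply: (conjE _ _ u); have -> : [~ u^-1, y] ^ u = [~ u, y]^-1.
      rewrite /commg /conjg !invgM !invgK !mulgA.
      by do !rewrite ?(mulgK, mulgVK, mulgV, mulVg, mul1g, mulg1).
    exact: lower_centralV.
move=> _ [g _ [u iu <-]] /=.
have := Hall_Witt g u^-1 y; rewrite invgK => /eqP; rewrite mulg_eq1 => /eqP E.
apply: (conjE _ _ u^-1); rewrite E; apply: lower_centralV; apply: lower_centralM.
  apply/lower_centralJ/lower_centralRC; rewrite addSn; apply: lower_centralR1 => //.
  by apply: IH; exact: lower_centralV.
apply/lower_centralJ/lower_centralRC; rewrite addSnnS.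
apply: IH; first exact: lower_centralV.
exact/lower_centralRC/lower_centralR1.
Qed.

(** Constant from k+1 on, so an element of weight above k may be discarded in any weight. This
    provides [D_stop], which keeps the set of letters finite during elimination. *)
Definition trunc_lower_central (k j : nat) : set G := gam (minn j k.+1).

Lemma trunc_lower_central_N k : N_series (trunc_lower_central k).
Proof.
split=> [|j|j x|i j x y]; rewrite /trunc_lower_central.
- by rewrite (minn_idPl _).
- exact: lower_central_subgroup.
- by apply: lower_central_le; rewrite leq_min geq_minr leqW ?geq_minl.
- move=> ix jy; apply: lower_central_le (lower_centralR ix jy); lia.
Qed.

End LowerCentral.

(** * Lie polynomials evaluated jointly in a group and at operators *)

Section LiePairs.
Local Open Scope ring_scope.
Variable G : groupType.

(** Bare maps on rational vectors over an arbitrary index type, because J is replaced by nat * J at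
    each elimination; additivity is carried separately. *)
Definition operator (J : Type) := (J -> rat) -> (J -> rat).

Definition brop (J : Type) (t t' : operator J) : operator J :=
  fun v => t (t' v) - t' (t v).

(* [lie_pair D d x X j w t]: some homogeneous Lie polynomial of weight j, in
   letters i of weight d i, evaluates to w modulo D j.+1 at the group elements
   x i, and to t at the operators X i. *)
Inductive lie_pair (D : nat -> set G) (I : Type) (d : I -> nat) (x : I -> G)
    (J : Type) (X : I -> operator J) : nat -> G -> operator J -> Prop :=
| lie_pair0 j w : D j.+1 w -> lie_pair D d x X j w 0
| lie_pair_letter i : lie_pair D d x X (d i) (x i) (X i)
| lie_pairM j w w' t t' : lie_pair D d x X j w t -> lie_pair D d x X j w' t' ->
    lie_pair D d x X j (w * w')%g (t + t')
| lie_pairV j w t : lie_pair D d x X j w t -> lie_pair D d x X j w^-1%g (- t)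
| lie_pairR i j w w' t t' : lie_pair D d x X i w t -> lie_pair D d x X j w' t' ->
    lie_pair D d x X (i + j) [~ w, w']%g (brop t t').

End LiePairs.

Section LiePairTheory.
Local Open Scope ring_scope.
Variables (G : groupType) (D : nat -> set G) (D_N : N_series D).
Variables (I : Type) (d : I -> nat) (x : I -> G) (J : Type) (X : I -> operator J).
Hypothesis Dx : forall i, D (d i) (x i).
Hypothesis Xadd : forall i, {morph X i : u v / u + v}.
Local Notation S := (lie_pair D d x X).

Lemma lie_pair_mem j w t : S j w t -> D j w.
Proof.
elim=> {j w t} [j w Dw|i|j w w' t t' _ + _|j w t _|i j w w' t t' _ + _] //.
- exact: N_series_le (leqnSn _) Dw.
- exact: N_seriesM.
- exact: N_seriesV.
- exact: N_seriesR.
Qed.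

Lemma additive0 (t : operator J) : {morph t : u v / u + v} -> t 0 = 0.
Proof. by move=> tD; apply: (addrI (t 0)); rewrite -tD !addr0. Qed.

Lemma additiveN (t : operator J) : {morph t : u v / u + v} -> {morph t : u / - u}.
Proof.
by move=> tD u; apply: (addrI (t u)); rewrite -tD !subrr additive0.
Qed.

Lemma additiveB (t : operator J) : {morph t : u v / u + v} -> {morph t : u v / u - v}.
Proof. by move=> tD u v; rewrite tD additiveN. Qed.

Lemma brop_additive (t t' : operator J) : {morph t : u v / u + v} ->
  {morph t' : u v / u + v} -> {morph brop t t' : u v / u + v}.
Proof. by move=> tD tD' u v; rewrite /brop !(tD, tD') opprD addrACA. Qed.

Lemma lie_pair_additive j w t : S j w t -> {morph t : u v / u + v}.
Proof.
elim=> {j w t} [j w Dw|i|j w w' t t' _ tD _ tD'|j w t _ tD|i j w w' t t' _ tD _ tD'] //.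
- move=> u v; change (t (u + v) + t' (u + v) = (t u + t' u) + (t v + t' v)).
  by rewrite tD tD' addrACA.
- by move=> u v; change (- t (u + v) = - t u + - t v); rewrite tD opprD.
- exact: brop_additive.
Qed.

Lemma lie_pair_cong j w w' t : S j w t -> Ncong D j.+1 w w' -> S j w' t.
Proof.
move=> Sw ww'; have -> : w' = (w * (w^-1 * w'))%g by rewrite mulgA mulgV mul1g.
by rewrite -[t]addr0; apply: lie_pairM => //; exact: lie_pair0.
Qed.

End LiePairTheory.

Section OperatorAlgebra.
Local Open Scope ring_scope.
Variable J : Type.
Implicit Types (t c : operator J) (v : J -> rat).
Local Notation additive t := {morph t : u v / u + v}.

Lemma addopE t t' v : (t + t') v = t v + t' v. Proof. by []. Qed.
Lemma oppopE t v : (- t) v = - t v. Proof. by []. Qed.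
Lemma zeroopE v : (0 : operator J) v = 0. Proof. by []. Qed.
Lemma addfE v v' j : (v + v') j = v j + v' j. Proof. by []. Qed.
Lemma oppfE v j : (- v) j = - v j. Proof. by []. Qed.

Lemma brop0r t : additive t -> brop t 0 = 0.
Proof. by move=> tD; apply/funext=> v; rewrite /brop !zeroopE additive0 // subrr. Qed.

Lemma brop0l t : additive t -> brop 0 t = 0.
Proof. by move=> tD; apply/funext=> v; rewrite /brop !zeroopE additive0 // subrr. Qed.

Lemma bropC t t' : brop t t' = - brop t' t.
Proof. by apply/funext=> v; rewrite /brop oppopE opprB. Qed.

Lemma bropDr t t1 t2 : additive t -> brop t (t1 + t2) = brop t t1 + brop t t2.
Proof.
move=> tD; apply/funext=> v; rewrite /brop !addopE tD opprD.
exact: addrACA.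
Qed.

Lemma bropDl t t1 t2 : additive t -> brop (t1 + t2) t = brop t1 t + brop t2 t.
Proof. by move=> tD; rewrite bropC bropDr // opprD -(bropC t1) -(bropC t2). Qed.

Lemma bropNr t t1 : additive t -> brop t (- t1) = - brop t t1.
Proof.
move=> tD; apply/funext=> v; rewrite [RHS]oppopE /brop !oppopE (additiveN tD).
by rewrite opprB opprK addrC.
Qed.

Lemma bropNl t t1 : additive t -> brop (- t1) t = - brop t1 t.
Proof. by move=> tD; rewrite bropC bropNr // -bropC. Qed.

Lemma brop_Jacobi t t1 t2 : additive t -> additive t1 -> additive t2 ->
  brop t (brop t1 t2) = brop (brop t t1) t2 + brop t1 (brop t t2).
Proof.
move=> tD t1D t2D; apply/funext=> v; rewrite addopE /brop !(additiveB tD, additiveB t1D, additiveB t2D).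
by apply/funext=> j; rewrite !(addfE, oppfE); ring.
Qed.

End OperatorAlgebra.

(** * Lazard elimination of one letter *)

Section Elimination.
Local Open Scope ring_scope.
Variables (G : groupType) (D : nat -> set G) (D_N : N_series D).
Variables (I' : Type) (d' : I' -> nat) (x' : I' -> G) (J : Type) (X' : I' -> operator J).
Hypothesis Dx' : forall i, D (d' i) (x' i).
Hypothesis X'D : forall i, {morph X' i : u v / u + v}.
Local Notation S' := (lie_pair D d' x' X').
Variables (s : nat) (z0 : G) (Z : operator J).
Hypothesis Dz0 : D s z0.
Hypothesis ZD : {morph Z : u v / u + v}.

(** The Lie polynomials in the single letter [z0]: its integer multiples, concentrated in weight
    s. *)
Inductive power_pair : nat -> G -> operator J -> Prop :=
| power_pair0 j w : D j.+1 w -> power_pair j w 0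
| power_pair1 : power_pair s z0 Z
| power_pairM j w w' t t' : power_pair j w t -> power_pair j w' t' ->
    power_pair j (w * w')%g (t + t')
| power_pairV j w t : power_pair j w t -> power_pair j w^-1%g (- t).

Lemma power_pair_mem j w t : power_pair j w t -> D j w.
Proof.
elim=> {j w t} [j w Dw||j w w' t t' _ + _|j w t _] //.
- exact: N_series_le (leqnSn _) Dw.
- exact: N_seriesM.
- exact: N_seriesV.
Qed.

Lemma power_pair_additive j w t : power_pair j w t -> {morph t : u v / u + v}.
Proof.
elim=> {j w t} [j w Dw||j w w' t t' _ tD _ tD'|j w t _ tD] // u v.
- by rewrite !addopE tD tD' addrACA.
- by rewrite !oppopE tD opprD.
Qed.

Lemma power_pair_off j w t : power_pair j w t -> j <> s -> D j.+1 w /\ t = 0.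
Proof.
elim=> {j w t} [j w Dw||j w w' t t' _ IH _ IH'|j w t _ IH] // js.
- have [[Dw ->] [Dw' ->]] := (IH js, IH' js).
  by split; rewrite ?addr0 //; exact: N_seriesM.
- by have [Dw ->] := IH js; split; rewrite ?oppr0 //; exact: N_seriesV.
Qed.

Lemma power_pair_comm i j w w' t t' : power_pair i w t -> power_pair j w' t' ->
  D (i + j).+1 [~ w, w']%g /\ brop t t' = 0.
Proof.
have right k w1 t1 : D k w1 -> {morph t1 : u v / u + v} ->
    (D (k + s).+1 [~ w1, z0]%g /\ brop t1 Z = 0) ->
    power_pair j w' t' -> D (k + j).+1 [~ w1, w']%g /\ brop t1 t' = 0.
  move=> Dw1 t1D H Pw'; elim: Pw' H => {j w' t'} [j w0 Dw0||j w2 w3 t2 t3 P2 IH2 P3 IH3|j w2 t2 P2 IH2] H //.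
  - by rewrite -addnS brop0r //; split=> //; exact: N_seriesR.
  - have [[c2 b2] [c3 b3]] := (IH2 H, IH3 H); rewrite bropDr // b2 b3 addr0; split=> //.
    apply: (Ncong_memr D_N) (N_seriesM D_N c2 c3); apply: Ncong_sym => //.
    by apply: NcongRMr => //; exact: power_pair_mem P2.
  - have [c2 b2] := IH2 H; rewrite bropNr // b2 oppr0; split=> //.
    apply: (Ncong_memr D_N) (N_seriesV D_N c2); apply: Ncong_sym => //.
    by apply: NcongRVr => //; exact: power_pair_mem P2.
move=> Pw Pw'; apply: right => //; [exact: power_pair_mem Pw|exact: power_pair_additive Pw|].
elim: Pw => {i w t} [i w Dw||i w2 w3 t2 t3 P2 [c2 b2] P3 [c3 b3]|i w2 t2 P2 [c2 b2]].
- by rewrite brop0l //; split=> //; rewrite -addSn; exact: N_seriesR.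
- rewrite commgg; split; first exact: N_series1.
  by apply/funext=> v; rewrite /brop subrr.
- rewrite bropDl // b2 b3 addr0; split=> //.
  apply: (Ncong_memr D_N) (N_seriesM D_N c2 c3); apply: Ncong_sym => //.
  by apply: NcongRMl => //; exact: power_pair_mem P2.
- rewrite bropNl // b2 oppr0; split=> //.
  apply: (Ncong_memr D_N) (N_seriesV D_N c2); apply: Ncong_sym => //.
  by apply: NcongRVl => //; exact: power_pair_mem P2.
Qed.

Hypothesis bracket_letter : forall i, S' (s + d' i) [~ z0, x' i]%g (brop Z (X' i)).

(** By the Jacobi identity the bracket with [z0] is a derivation, so it preserves the Lie
    polynomials in the primed letters once it does so on letters, which is [bracket_letter]. *)
Lemma lie_pair_ad i w t : S' i w t -> S' (s + i) [~ z0, w]%g (brop Z t).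
Proof.
elim=> {i w t} [j w Dw|i|j w w' t t' P IH P' IH'|j w t P IH|i j w w' t t' P IH P' IH'] //.
- by rewrite brop0r //; apply: lie_pair0; rewrite -addnS; exact: N_seriesR.
- rewrite bropDr //; apply: lie_pair_cong (lie_pairM IH IH') _ => //.
  by apply: Ncong_sym => //; apply: NcongRMr => //; exact: lie_pair_mem P.
- rewrite bropNr //; apply: lie_pair_cong (lie_pairV IH) _ => //.
  by apply: Ncong_sym => //; apply: NcongRVr => //; exact: lie_pair_mem P.
- have tD : {morph t : u v / u + v} by exact: lie_pair_additive P.
  have tD' : {morph t' : u v / u + v} by exact: lie_pair_additive P'.
  have := lie_pairR IH P'; have := lie_pairR P IH'.
  have -> : (i + (s + j) = s + i + j)%N by lia.
  move=> Q Q'; rewrite brop_Jacobi // addnA.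
  apply: lie_pair_cong (lie_pairM Q' Q) _ => //.
  apply: Ncong_sym => //; apply: Ncong_Jacobi => //; exact: lie_pair_mem P || exact: lie_pair_mem P'.
Qed.

Lemma power_pair_ad j i z c w t : power_pair j z c -> S' i w t ->
  S' (j + i) [~ z, w]%g (brop c t).
Proof.
move=> + Sw; have tD : {morph t : u v / u + v} by exact: lie_pair_additive Sw.
have Dw : D i w by exact: lie_pair_mem Sw.
elim=> {j z c} [j w1 Dw1||j w2 w3 t2 t3 P2 IH2 P3 IH3|j w2 t2 P2 IH2].
- by rewrite brop0l //; apply: lie_pair0; rewrite -addSn; exact: N_seriesR.
- exact: lie_pair_ad.
- rewrite bropDl //; apply: lie_pair_cong (lie_pairM IH2 IH3) _ => //.
  by apply: Ncong_sym => //; apply: NcongRMl => //; exact: power_pair_mem P2.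
- rewrite bropNl //; apply: lie_pair_cong (lie_pairV IH2) _ => //.
  by apply: Ncong_sym => //; apply: NcongRVl => //; exact: power_pair_mem P2.
Qed.

Variables (I : Type) (d : I -> nat) (x : I -> G) (X : I -> operator J).
Hypothesis letterP : forall i,
  power_pair (d i) (x i) (X i) \/ S' (d i) (x i) (X i).

(** The line of [z0] plus the Lie polynomials in the primed letters is closed under brackets: the
    line commutes with itself and acts on the second summand. A bracket therefore has no component
    on the line. *)
Lemma lazard_elimination j w t : lie_pair D d x X j w t ->
  exists z c w' t', [/\ power_pair j z c, S' j w' t',
    Ncong D j.+1 w (z * w')%g & t = c + t'].
Proof.
elim=> {j w t} [j w Dw|i|j w1 w2 t1 t2 _ IH1 _ IH2|j w t _ IH|i j w1 w2 t1 t2 _ IH1 _ IH2].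
- exists 1%g, 0, w, 0; split; rewrite ?addr0 ?mul1g //; last exact: Ncong_refl.
    by apply: power_pair0; exact: N_series1.
  exact: lie_pair0.
- case: (letterP i) => P.
    exists (x i), (X i), 1%g, 0; split; rewrite ?mulg1 ?addr0 //; last exact: Ncong_refl.
    by apply: lie_pair0; exact: N_series1.
  exists 1%g, 0, (x i), (X i); split; rewrite ?mul1g ?add0r //; last exact: Ncong_refl.
  by apply: power_pair0; exact: N_series1.
- have [z1 [c1 [u1 [s1 [P1 S1 e1 ->]]]]] := IH1.
  have [z2 [c2 [u2 [s2 [P2 S2 e2 ->]]]]] := IH2.
  exists (z1 * z2)%g, (c1 + c2), (u1 * u2)%g, (s1 + s2); split.
  + exact: power_pairM.
  + exact: lie_pairM.
  + apply: (Ncong_trans D_N (NcongM D_N e1 e2)).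
    rewrite -!mulgA; apply: NcongM => //; first exact: Ncong_refl.
    rewrite !mulgA; apply: NcongM => //; last exact: Ncong_refl.
    by apply: NcongCS => //; exact: lie_pair_mem S1.
  + exact: addrACA.
- have [z [c [u [t' [P Su e ->]]]]] := IH.
  exists z^-1%g, (- c), u^-1%g, (- t'); split; rewrite ?opprD //.
  + exact: power_pairV.
  + exact: lie_pairV.
  + apply: (Ncong_trans D_N (NcongV D_N e)); rewrite invgM.
    by apply: NcongCS => //; apply: N_seriesV => //; exact: lie_pair_mem Su.
- have [z1 [c1 [u1 [s1 [P1 S1 e1 ->]]]]] := IH1.
  have [z2 [c2 [u2 [s2 [P2 S2 e2 ->]]]]] := IH2.
  have [Dz1 Dz2] := (power_pair_mem P1, power_pair_mem P2).
  have Du1 : D i u1 by exact: lie_pair_mem S1.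
  have Du2 : D j u2 by exact: lie_pair_mem S2.
  have [c1D c2D] := (power_pair_additive P1, power_pair_additive P2).
  have s1D : {morph s1 : u v / u + v} by exact: lie_pair_additive S1.
  have s2D : {morph s2 : u v / u + v} by exact: lie_pair_additive S2.
  have [Dzz bzz] := power_pair_comm P1 P2.
  have Q1 := power_pair_ad P1 S2.
  have Q2 := lie_pairV (power_pair_ad P2 S1); rewrite addnC invgR -bropC in Q2.
  have Q := lie_pairM (lie_pairM (lie_pair0 _ _ _ Dzz) Q1) (lie_pairM Q2 (lie_pairR S1 S2)).
  exists 1%g, 0; do 2!eexists; split; [|exact: Q| |].
  + by apply: power_pair0; exact: N_series1.
  + rewrite mul1g.
    have D1 := N_seriesM D_N Dz1 Du1; have D2 := N_seriesM D_N Dz2 Du2.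
    have D1' : D i w1 by apply: (Ncong_memr D_N) D1; apply: Ncong_sym => //; exact: Ncong_le e1.
    have D2' : D j w2 by apply: (Ncong_memr D_N) D2; apply: Ncong_sym => //; exact: Ncong_le e2.
    apply: (Ncong_trans D_N (NcongR D_N D1' D2' e1 e2)).
    apply: (Ncong_trans D_N (NcongRMl D_N u1 Dz1 D2)).
    by apply: NcongM => //; exact: NcongRMr.
  + have c2s2D : {morph c2 + s2 : u v / u + v}.
      by move=> u v; rewrite !addopE c2D s2D addrACA.
    by rewrite bropDl // !bropDr // bzz !add0r.
Qed.

Lemma lazard_elimination_off j w t : j <> s -> lie_pair D d x X j w t -> S' j w t.
Proof.
move=> js L; have [z [c [w' [t' [P Sw e ->]]]]] := lazard_elimination L.
have [Dz ->] := power_pair_off P js; rewrite add0r.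
apply: lie_pair_cong Sw _ => //; apply: Ncong_sym => //.
apply: (Ncong_trans D_N e); rewrite -[X in Ncong _ _ _ X]mul1g.
apply: NcongM => //; last exact: Ncong_refl.
by apply: Ncong_sym => //; apply/Ncong1.
Qed.

End Elimination.

(** * Faithful operators when all letters have weight at least k *)

Section FaithfulOperators.
Local Open Scope ring_scope.
Variables (G : groupType) (D : nat -> set G) (D_N : N_series D).

(* Lie polynomials of weight k vanish in gr_k as soon as they vanish at the operators X i. *)
Definition faithful_operators (k : nat) (I J : Type) (d : I -> nat) (x : I -> G)
    (X : I -> operator J) : Prop :=
  (forall i, {morph X i : u v / u + v}) /\
  forall w t, lie_pair D d x X k w t -> t = 0 -> D k.+1 w.

Lemma word_eval_cat (X : Type) (f : X -> G) u v :
  word_eval f (u ++ v) = (word_eval f u * word_eval f v)%g.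
Proof. by rewrite /word_eval big_cat. Qed.

Lemma word_eval_cons (X : Type) (f : X -> G) y b u :
  word_eval f ((y, b) :: u) = ((if b then (f y)^-1 else f y) * word_eval f u)%g.
Proof. by rewrite /word_eval big_cons. Qed.

Lemma word_eval_winv (X : choiceType) (f : X -> G) u :
  word_eval f (winv u) = (word_eval f u)^-1%g.
Proof.
elim: u => [|[y b] u IH]; first by rewrite /word_eval !big_nil invg1.
rewrite word_eval_cons invgM -IH /winv /= rev_cons -cats1 word_eval_cat.
rewrite {2}/word_eval big_seq1 /=; congr (_ * _)%g.
by case: b; rewrite //= invgK.
Qed.

(** Elements of [D k] are central modulo [D k.+1], so the first letter can be moved next to an
    inverse occurrence and cancelled. *)
Lemma balanced_word_eval (I : eqType) (x : I -> G) k (l : word I) :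
  (forall i, D k (x i)) ->
  (forall i, count_mem (i, false) l = count_mem (i, true) l) ->
  D k.+1 (word_eval x l).
Proof.
move=> Dx; have [n] := ubnP (size l); elim: n l => // n IH [|[i b] l] /= szl bal.
  by rewrite /word_eval big_nil; exact: N_series1.
have il : (i, ~~ b) \in l.
  rewrite -has_pred1 has_count; move: (bal i); rewrite !xpair_eqE !eqxx /=.
  by case: b {bal} => /= H; lia.
have [l1 [l2 El]] : exists l1 l2, l = l1 ++ (i, ~~ b) :: l2.
  by have /path.splitPr[l1 l2] := il; exists l1, l2.
have Dl : D k.+1 (word_eval x (l1 ++ l2)).
  apply: IH => [|j]; first by move: szl; rewrite El !size_cat /=; lia.
  move: (bal j); rewrite El !count_cat /= !xpair_eqE.
  by case: b {bal il El}; case: (i == j) => /=; lia.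
have Dk m : D k (word_eval x m).
  rewrite /word_eval; elim: m => [|[y c] m IHm]; first by rewrite big_nil; exact: N_series1.
  rewrite big_cons; apply: N_seriesM => //=.
  by case: c; [apply: N_seriesV|].
apply: (Ncong_memr D_N) Dl.
rewrite El -cat1s !word_eval_cat -[_ :: l2]cat1s word_eval_cat.
set a := word_eval x l1; set c := word_eval x [:: (i, b)].
have -> : word_eval x [:: (i, ~~ b)] = c^-1%g.
  by rewrite /c /word_eval !big_seq1 /=; case: b {bal il El c}; rewrite /= ?invgK.
rewrite !mulgA; apply: NcongM => //; last exact: Ncong_refl.
rewrite -[X in Ncong _ _ X](mulgK c a); apply: NcongM => //; last exact: Ncong_refl.
by apply: NcongCS => //; exact: Dk.
Qed.

Section Base.
Variables (k : nat) (I : choiceType) (d : I -> nat) (x : I -> G).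
Hypotheses (k_gt0 : (0 < k)%N) (Dx : forall i, D (d i) (x i)) (k_le : forall i, (k <= d i)%N).

(** Products of two of these vanish, so brackets are invisible, while a signed sum of letters
    applied to the basis vector at [None] displays the multiplicity of each letter. *)
Definition base_operator (i : I) : operator (option I) :=
  fun v o => if o is Some i' then (i' == i)%:R * v None else 0.

Lemma base_operator_additive i : {morph base_operator i : u v / u + v}.
Proof.
move=> u v; apply/funext=> -[j|]; rewrite /base_operator !addfE ?addr0 //.
by rewrite mulrDr.
Qed.

Lemma base_operator_comp i j v : base_operator i (base_operator j v) = 0.
Proof. by apply/funext=> -[l|] //=; rewrite mulr0. Qed.

Let S := lie_pair D d x base_operator.
Let sgnop (p : I * bool) : operator (option I) :=
  if p.2 then - base_operator p.1 else base_operator p.1.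

Let base_expand j w t : S j w t ->
  ((j < k)%N -> D j.+1 w /\ t = 0) /\
  (j = k -> exists l, Ncong D k.+1 w (word_eval x l) /\ t = \sum_(p <- l) sgnop p).
Proof.
elim=> {j w t} [j w Dw|i|j w1 w2 t1 t2 _ [IH1 IH1'] _ [IH2 IH2']|j w t _ [IH IH']|i j w1 w2 t1 t2 S1 [IH1 IH1'] S2 [IH2 IH2']].
- split=> // jk; exists [::]; rewrite /word_eval !big_nil; split=> //.
  by rewrite -jk; apply: Ncong_sym => //; apply/Ncong1.
- split=> [|_]; first by rewrite ltnNge k_le.
  exists [:: (i, false)]; rewrite /word_eval !big_seq1; split=> //=; exact: Ncong_refl.
- split=> [jk|jk].
    have [[D1 ->] [D2 ->]] := (IH1 jk, IH2 jk).
    by rewrite addr0; split=> //; exact: N_seriesM.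
  have [l1 [e1 ->]] := IH1' jk; have [l2 [e2 ->]] := IH2' jk.
  by exists (l1 ++ l2); rewrite word_eval_cat big_cat; split=> //; exact: NcongM.
- split=> [jk|jk].
    by have [D1 ->] := IH jk; rewrite oppr0; split=> //; exact: N_seriesV.
  have [l [e ->]] := IH' jk.
  exists (winv l); split; first by rewrite word_eval_winv; exact: NcongV.
  rewrite -sumrN (perm_big _ (permEl (perm_rev _))) big_map.
  by apply: eq_bigr => -[y []] _; rewrite /sgnop //= opprK.
- have [S1D S2D] := (lie_pair_mem D_N Dx S1, lie_pair_mem D_N Dx S2).
  have t1D := lie_pair_additive base_operator_additive S1.
  have t2D := lie_pair_additive base_operator_additive S2.
  (* Brackets contribute nothing up to weight k: two factors of weight at least k would give 2k > k,
     so one factor has weight below k and is already trivial. *)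
  suff main : (i + j <= k)%N -> D (i + j).+1 [~ w1, w2]%g /\ brop t1 t2 = 0.
    split=> [/ltnW|ijk]; first exact: main.
    have [] := main; first by rewrite ijk.
    move=> Dc ->; exists [::]; rewrite /word_eval !big_nil; split=> //.
    by rewrite -ijk; apply: Ncong_sym => //; apply/Ncong1.
  move=> ijk; have [ik|ki] := ltnP i k.
    have [D1 ->] := IH1 ik; rewrite brop0l //; split=> //.
    by rewrite -addSn; exact: N_seriesR.
  have [jk|kj] := ltnP j k.
    have [D2 ->] := IH2 jk; rewrite brop0r //; split=> //.
    by rewrite -addnS; exact: N_seriesR.
  by move: (leq_add ki kj); rewrite leqNgt (leq_ltn_trans ijk) // -addn1 leq_add2l.
Qed.

Lemma base_faithful : faithful_operators k d x base_operator.
Proof.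
split=> [|w t Sw t0]; first exact: base_operator_additive.
have [_ /(_ erefl)[l [e El]]] := base_expand Sw.
apply: (Ncong_memr D_N (Ncong_sym D_N e)).
apply: balanced_word_eval => [i|i]; first exact: N_series_le (Dx i).
pose e0 : option I -> rat := fun o => (o == None)%:R.
have eval l' : (\sum_(p <- l') sgnop p) e0 (Some i)
    = (count_mem (i, false) l')%:R - (count_mem (i, true) l')%:R.
  elim: l' => [|[y b] l' IHl]; first by rewrite big_nil subrr.
  rewrite big_cons addopE addfE IHl /sgnop /= !natrD !xpair_eqE.
  by case: b; rewrite /= ?oppopE ?oppfE /base_operator /e0 /= mulr1 !(andbT, andbF) /= (eq_sym y) ; ring.
have := eval l; rewrite -El t0 zeroopE => /esym/eqP; rewrite subr_eq0 eqr_nat => /eqP.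
by [].
Qed.

End Base.
End FaithfulOperators.

(** * Coinduced operators and the elimination step *)

Section CoinducedOperators.
Local Open Scope ring_scope.
Variable J : Type.

(* A vector indexed by nat * J is a sequence m_0, m_1, ... of vectors indexed by J. *)
Definition shift_op : operator (nat * J) := fun m p => m (p.1.+1, p.2).

Definition head_vec (m : nat * J -> rat) : J -> rat := fun j => m (0%N, j).

(** The unique solution y of [shift, y] = T acting as Y on the zeroth term: (y m)_(n+1) = (y (shift
    m))_n + (T m)_n. In the coinduced module the shift is the action of the eliminated letter. *)
Fixpoint lift_at (Y : operator J) (T : operator (nat * J)) (n : nat)
    (m : nat * J -> rat) : J -> rat :=
  if n is n'.+1 then lift_at Y T n' (shift_op m) + (fun j => T m (n', j))
  else Y (head_vec m).

Definition lift_op (Y : operator J) (T : operator (nat * J)) : operator (nat * J) :=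
  fun m p => lift_at Y T p.1 m p.2.

Lemma shift_op_additive : {morph shift_op : u v / u + v}.
Proof. by []. Qed.

Lemma head_lift_op Y T m : head_vec (lift_op Y T m) = Y (head_vec m).
Proof. by []. Qed.

Lemma brop_shift_lift Y T : brop shift_op (lift_op Y T) = T.
Proof.
apply/funext=> m; apply/funext=> -[n j].
by rewrite /brop addfE oppfE /lift_op /shift_op /= addfE [X in X - _]addrC addrK.
Qed.

Lemma lift_op_additive Y T : {morph Y : u v / u + v} -> {morph T : u v / u + v} ->
  {morph lift_op Y T : u v / u + v}.
Proof.
move=> YD TD u v; apply/funext=> -[n j]; rewrite addfE /lift_op /=.
rewrite -addfE; congr (_ _); elim: n u v {j} => [|n IH] u v /=; first exact: YD.
rewrite shift_op_additive IH TD; exact: addrACA.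
Qed.

End CoinducedOperators.

Section EliminationStep.
Local Open Scope ring_scope.
Variables (G : groupType) (D : nat -> set G) (D_N : N_series D) (k : nat).
Hypothesis D_stop : forall j w, D k.+1 w -> D j w.
Variables (I : eqType) (d : I -> nat) (x : I -> G) (Dx : forall i, D (d i) (x i)).
Variables (x0 : I) (d_gt0 : (0 < d x0)%N).
Let s := d x0.

(* (y, n) stands for ad(x0)^n y; the letters (x0, n) are void. *)
Definition elim_weight (z : I * 'I_k.+1) : nat :=
  if z.1 == x0 then k.+1 else (d z.1 + z.2 * s)%N.

Definition ad_iter (n : nat) (y : G) : G := iter n (commg (x x0)) y.

Definition elim_letter (z : I * 'I_k.+1) : G :=
  if z.1 == x0 then 1%g else ad_iter z.2 (x z.1).

Lemma elim_letter_mem z : D (elim_weight z) (elim_letter z).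
Proof.
case: z => y [n nk]; rewrite /elim_weight /elim_letter /=; case: eqP => _.
  exact: N_series1.
elim: n {nk} => [|n IH]; first by rewrite mul0n addn0; exact: Dx.
by rewrite mulSn addnCA; exact: (N_seriesR D_N (Dx x0) IH).
Qed.

Variables (J : Type) (Y : I * 'I_k.+1 -> operator J).
Hypothesis YD : forall z, {morph Y z : u v / u + v}.

(** The operator of ad(x0)^(k-r) y. Its commutator with the shift must be the operator with one
    bracket more, which has to exist first; hence the recursion on the number r of brackets still to
    come. *)
Fixpoint tower_op (y : I) (r : nat) : operator (nat * J) :=
  lift_op (Y (y, inord (k - r))) (if r is r'.+1 then tower_op y r' else 0).

Lemma tower_op_additive y r : {morph tower_op y r : u v / u + v}.
Proof.
by elim: r => [|r IH]; apply: lift_op_additive.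
Qed.

Lemma head_tower_op y r m :
  head_vec (tower_op y r m) = Y (y, inord (k - r)) (head_vec m).
Proof. by case: r. Qed.

Variables (sp : pred I) (T : operator (nat * J)).
Hypothesis TD : {morph T : u v / u + v}.
Hypothesis sp_x0 : ~~ sp x0.

(** The letters in [sp] are those whose bracket with [x0] is imposed by a relation: their operator
    is lifted along the prescribed [T] instead of starting a free tower. *)
Definition elim_op (z : I * 'I_k.+1) : operator (nat * J) :=
  if z.1 == x0 then lift_op (Y z) 0
  else if sp z.1 && (z.2 == ord0) then lift_op (Y z) T
  else tower_op z.1 (k - z.2).

Lemma elim_op_additive z : {morph elim_op z : u v / u + v}.
Proof.
rewrite /elim_op; case: eqP => _.
  exact: lift_op_additive.
case: ifP => _; [exact: lift_op_additive | exact: tower_op_additive].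
Qed.

Lemma head_elim_op z m : head_vec (elim_op z m) = Y z (head_vec m).
Proof.
rewrite /elim_op; case: eqP => _; first exact: head_lift_op.
case: ifP => _; first exact: head_lift_op.
have zE : (z.1, inord (k - (k - z.2))) = z.
  by case: z => y n /=; rewrite subKn ?inord_val // -ltnS.
by rewrite head_tower_op zE.
Qed.

Hypothesis special_bracket : forall y, sp y ->
  lie_pair D elim_weight elim_letter elim_op (s + d y) [~ x x0, x y]%g T.

Local Notation S' := (lie_pair D elim_weight elim_letter elim_op).

Lemma elim_bracket z :
  S' (s + elim_weight z) [~ x x0, elim_letter z]%g (brop (shift_op (J:=J)) (elim_op z)).
Proof.
have Dz := elim_letter_mem z.
case: z Dz => y n Dz.
have [yx|yx] := eqVneq y x0.
  rewrite /elim_op /elim_letter /= yx eqxx brop_shift_lift commg1.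
  by apply: lie_pair0; exact: N_series1.
have EW m : elim_weight (y, m) = (d y + m * s)%N by rewrite /elim_weight /= (negPf yx).
have EL m : elim_letter (y, m) = ad_iter m (x y) by rewrite /elim_letter /= (negPf yx).
have EO m : ~~ (sp y && (m == ord0)) -> elim_op (y, m) = tower_op y (k - m).
  by rewrite /elim_op /= (negPf yx) => /negPf->.
have [/andP[spy /eqP n0]|E] := boolP (sp y && (n == ord0)).
  rewrite EW EL n0 mul0n addn0 /elim_op /= (negPf yx) spy /= brop_shift_lift.
  exact: special_bracket.
rewrite (EO _ E).
(* At the top of the tower one more bracket has weight at least s + k s > k, since s > 0, and is
   discarded. *)
have [nk|nk] := ltnP n k; last first.
  have nE : n = k :> nat by apply/eqP; rewrite eqn_leq nk -ltnS ltn_ord.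
  rewrite nE subnn /= brop_shift_lift.
  apply: lie_pair0; apply: D_stop.
  apply: (N_series_le D_N) (N_seriesR D_N (Dx x0) Dz); rewrite -/s EW nE.
  by have : (k <= k * s)%N by [rewrite leq_pmulr]; lia.
have nS : (n.+1 < k.+1)%N by [].
have := lie_pair_letter D elim_weight elim_letter elim_op (y, Ordinal nS).
rewrite !EW !EL EO ?andbF //= mulSn addnCA.
by rewrite -(subnSK nk) /= brop_shift_lift.
Qed.

Definition restored_op (y : I) : operator (nat * J) :=
  if y == x0 then @shift_op J else elim_op (y, ord0).

Lemma restored_op_additive y : {morph restored_op y : u v / u + v}.
Proof.
by rewrite /restored_op; case: eqP => _; [exact: shift_op_additive | exact: elim_op_additive].
Qed.

(** Taking the zeroth term intertwines [elim_op] with [Y], hence also all Lie polynomials in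
    them. *)
Lemma elim_head_pair j w t : S' j w t ->
  exists t', lie_pair D elim_weight elim_letter Y j w t' /\
    forall m, head_vec (t m) = t' (head_vec m).
Proof.
elim=> {j w t} [j w Dw|i|j w1 w2 t1 t2 _ [t1' [P1 E1]] _ [t2' [P2 E2]]|j w t _ [t' [P E]]|i j w1 w2 t1 t2 _ [t1' [P1 E1]] _ [t2' [P2 E2]]].
- by exists 0; split=> //; exact: lie_pair0.
- by exists (Y i); split=> [|m]; [exact: lie_pair_letter | exact: head_elim_op].
- exists (t1' + t2'); split=> [|m]; first exact: lie_pairM.
  by rewrite [RHS]addopE -E1 -E2.
- exists (- t'); split=> [|m]; first exact: lie_pairV.
  by rewrite [RHS]oppopE -E.
- exists (brop t1' t2'); split=> [|m]; first exact: lie_pairR.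
  change (head_vec (t1 (t2 m)) - head_vec (t2 (t1 m)) =
    t1' (t2' (head_vec m)) - t2' (t1' (head_vec m))).
  by rewrite !E1 !E2 !E1.
Qed.

(** In weight k, different from that of [x0], elimination leaves a Lie polynomial in the new letters
    only, and its vanishing passes to [Y] through the zeroth term. *)
Lemma elim_faithful : d x0 <> k ->
  faithful_operators D k elim_weight elim_letter Y ->
  faithful_operators D k d x restored_op.
Proof.
move=> sk [_ F]; split=> [|w t Sw t0]; first exact: restored_op_additive.
have letters i : power_pair D s (x x0) (@shift_op J) (d i) (x i) (restored_op i)
    \/ S' (d i) (x i) (restored_op i).
  have [->|ix] := eqVneq i x0.
    by left; rewrite /restored_op eqxx; exact: power_pair1.
  right; rewrite /restored_op (negPf ix).
  have := lie_pair_letter D elim_weight elim_letter elim_op (i, ord0).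
  have -> : elim_weight (i, ord0) = d i by rewrite /elim_weight /= (negPf ix) mul0n addn0.
  by have -> : elim_letter (i, ord0) = x i by rewrite /elim_letter /= (negPf ix).
have ks : k <> s by move=> e; apply: sk; rewrite -/s.
have := @lazard_elimination_off G D D_N _ elim_weight elim_letter _ elim_op
   elim_letter_mem elim_op_additive s (x x0) (@shift_op J) (Dx x0)
   (@shift_op_additive J) elim_bracket I d x restored_op letters k w t ks Sw.
move=> /elim_head_pair[t' [P E]]; apply: (F w t' P).
(* Every vector is the zeroth term of a constant sequence. *)
apply/funext=> v; have := E (fun p => v p.2).
by rewrite t0 => /esym.
Qed.

End EliminationStep.

(** * Faithful operators without relation, and with the surface relation *)

Section FreeFaithful.
Local Open Scope ring_scope.
Variables (G : groupType) (D : nat -> set G) (D_N : N_series D) (k : nat).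
Hypothesis D_stop : forall j w, D k.+1 w -> D j w.
Hypothesis k_gt0 : (0 < k)%N.

(** Eliminating a letter of least weight s keeps the other letters and adds only brackets of weight
    above s, so there are fewer letters of weight s. When none is left s can grow, until all weights
    reach k. *)
Lemma free_faithful (r s : nat) (I : finType) (d : I -> nat) (x : I -> G) :
  (s + r = k)%N -> (0 < s)%N -> (forall i, D (d i) (x i)) -> (forall i, (s <= d i)%N) ->
  exists (J : Type) (X : I -> operator J), faithful_operators D k d x X.
Proof.
elim: r s I d x => [|r IH] s I d x sr s0 Dx sd.
  exists (option I), (base_operator (I:=I)); apply: base_faithful => // i.
  by rewrite -sr addn0.
have [n] := ubnP #|[pred i | d i == s]|.
elim: n I d x Dx sd => // n IHn I d x Dx sd szn.
have [/existsP[x0 /eqP dx0]|/existsPn no] := boolP [exists i, d i == s]; last first.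
  apply: (IH s.+1) => // [|i]; first by rewrite addSnnS.
  by rewrite ltn_neqAle sd andbT eq_sym no.
have d0 : (0 < d x0)%N by rewrite dx0.
have [|||J [Y F]] := IHn _ (elim_weight (k:=k) d x0) (elim_letter (k:=k) x x0).
- exact: elim_letter_mem.
- move=> [y i]; rewrite /elim_weight /=; case: eqP => _; last by rewrite (leq_trans (sd y)) ?leq_addr.
  by rewrite -sr -addnS leq_addr.
- apply: leq_trans (szn : (_ <= n)%N).
  have /subset_leq_card : [pred z : I * 'I_k.+1 | elim_weight d x0 z == s]
    \subset [seq (y, ord0) | y in [pred i | d i == s & i != x0]].
    apply/fintype.subsetP=> -[y i]; rewrite inE /elim_weight /= dx0.
    have [->|yx] := eqVneq y x0; first by move/eqP; lia.
    move=> /eqP E; have i0 : i = ord0.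
      apply/val_inj => /=; have := sd y; case: (nat_of_ord i) E => // i' E'.
      by move: E'; rewrite mulSn; lia.
    apply/fintype.imageP; exists y; last by rewrite i0.
    by rewrite !inE yx andbT; move: E; rewrite i0 mul0n addn0 => ->.
  move/leq_ltn_trans; apply; rewrite fintype.card_image; last by move=> a b [].
  apply: proper_card; apply/fintype.properP; split.
    by apply/fintype.subsetP=> y; rewrite !inE => /andP[].
  by exists x0; rewrite !inE ?dx0 ?eqxx ?andbF.
exists (nat * J)%type, (restored_op x0 Y pred0 0).
apply: elim_faithful => //.
- by case: F.

- by rewrite dx0; lia.
Qed.

End FreeFaithful.

Section SurfaceRelation.
Local Open Scope ring_scope.
Variables (G : groupType) (D : nat -> set G) (D_N : N_series D) (k : nat).
Hypothesis D_stop : forall j w, D k.+1 w -> D j w.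
Hypothesis k_gt0 : (0 < k)%N.

Lemma word_eval_surface_relator (g : nat) (x : 'I_g + 'I_g -> G) :
  word_eval x (surface_relator g) =
  (\prod_(i < g) (x (inl i) * x (inr i) * (x (inl i))^-1 * (x (inr i))^-1))%g.
Proof.
transitivity (\prod_(i <- enum 'I_g)
  (x (inl i) * x (inr i) * (x (inl i))^-1 * (x (inr i))^-1))%g; last by rewrite enumT [index_enum _]unlock.
rewrite /surface_relator.
elim: (enum 'I_g) => [|i l IH] /=; first by rewrite /word_eval !big_nil.
by rewrite !word_eval_cons IH big_cons !mulgA.
Qed.

(** Reconciles two conventions: [[~ y, z]] is y^-1 z^-1 y z, whereas the relator uses y z y^-1 z^-1.
    Modulo weight 3 the two inversions give two signs that cancel. *)
Lemma Ncong_commV y z : Ncong D 3 (y * z * y^-1 * z^-1)%g [~ y, z]%g.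
Proof.
have -> : (y * z * y^-1 * z^-1 = [~ y^-1, z^-1])%g.
  by rewrite /commg /conjg !invgK !mulgA.
have T := N_seriesT D_N; have TV u : D 1%N u^-1%g by exact: T.
apply: (Ncong_trans D_N (NcongRVl D_N (T y) (TV z))).
rewrite -[X in Ncong _ _ _ X]invgK; apply: NcongV => //.
exact: (NcongRVr D_N (T y) (T z)).
Qed.

Lemma surface_faithful (g : nat) (x : 'I_g + 'I_g -> G) :
  (0 < g)%N -> word_eval x (surface_relator g) = 1%g ->
  exists (J : Type) (X : 'I_g + 'I_g -> operator J),
    faithful_operators D k (fun=> 1%N) x X /\
    \sum_(i < g) brop (X (inl i)) (X (inr i)) = 0.
Proof.
case: g x => // g x _ rel; have Dx i : D 1%N (x i) by exact: N_seriesT.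
(* For k = 1 the letter to eliminate would itself have weight k, which [elim_faithful] excludes; the
   base operators satisfy the relation because their products vanish. *)
have [k1|k1] := eqVneq k 1%N.
  exists (option ('I_g.+1 + 'I_g.+1)), (base_operator (I:='I_g.+1 + 'I_g.+1)%type).
  split; first by apply: base_faithful => // i; rewrite k1.
  rewrite big1 // => i _; apply/funext=> v.
  by rewrite /brop !base_operator_comp subrr.
pose I := ('I_g.+1 + 'I_g.+1)%type; pose x0 : I := inl ord0.
pose d : I -> nat := fun=> 1%N.
have [||||J [Y F]] := @free_faithful G D D_N k D_stop k_gt0 k.-1 1 _
    (elim_weight (k:=k) d x0) (elim_letter (k:=k) x x0).
- by rewrite add1n prednK.
- by [].
- by apply: elim_letter_mem.
- move=> z; rewrite /elim_weight; case: eqP => _ //.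
have YD := F.1.
pose A (j : 'I_g) : I := inl (lift ord0 j); pose B (j : 'I_g) : I := inr (lift ord0 j).
(* The bracket [a_1, b_1] dictated by the relation. It involves only the towers of the remaining
   generators, so defining the operator of b_1 from it is not circular. *)
pose T : operator (nat * J) := - \sum_(j < g) brop (tower_op Y (A j) k) (tower_op Y (B j) k).
pose sp : pred I := fun y => y == inr ord0.
have TD : {morph T : u v / u + v}.
  move=> u v; rewrite /T !oppopE -opprD; congr (- _).
  elim/big_ind: _ u v => [//|t t' tD tD' u v|j _]; first by rewrite !addopE tD tD' addrACA.
  by apply: brop_additive; exact: tower_op_additive.
have regular y : y != x0 -> ~~ sp y ->
    lie_pair D (elim_weight (k:=k) d x0) (elim_letter (k:=k) x x0) (elim_op x0 Y sp T)
      1 (x y) (tower_op Y y k).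
  move=> yx0 ysp.
  have := lie_pair_letter D (elim_weight (k:=k) d x0) (elim_letter x x0) (elim_op x0 Y sp T) (y, ord0).
  have -> : elim_weight d x0 (y, ord0 : 'I_k.+1) = 1%N by rewrite /elim_weight /= (negPf yx0).
  have -> : elim_letter x x0 (y, ord0 : 'I_k.+1) = x y by rewrite /elim_letter /= (negPf yx0).
  by have -> : elim_op x0 Y sp T (y, ord0) = tower_op Y y k
    by rewrite /elim_op /= (negPf yx0) (negPf ysp) /= subn0.
have special y : sp y ->
    lie_pair D (elim_weight (k:=k) d x0) (elim_letter x x0) (elim_op x0 Y sp T)
    (d x0 + d y) [~ x x0, x y]%g T.
  move=> /eqP->; rewrite /d.
  have P : lie_pair D (elim_weight (k:=k) d x0) (elim_letter x x0) (elim_op x0 Y sp T)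
      2 (\prod_(j < g) [~ x (A j), x (B j)])%g
      (\sum_(j < g) brop (tower_op Y (A j) k) (tower_op Y (B j) k)).
    elim/big_rec2: _ => [|j t w _ IH]; first by apply: lie_pair0; exact: N_series1.
    by apply: lie_pairM IH; apply: (lie_pairR (i := 1) (j := 1)); exact: regular.
  suff c : Ncong D 3 (\prod_(j < g) [~ x (A j), x (B j)])^-1%g [~ x x0, x (inr ord0)]%g.
    exact: (lie_pair_cong (lie_pairV P) c).
  apply: Ncong_sym => //.
  move: rel; rewrite word_eval_surface_relator big_ord_recl => rel.
  have c0 := Ncong_commV (x x0) (x (inr ord0)).
  have cs : Ncong D 3 (\prod_(j < g) (x (A j) * x (B j) * (x (A j))^-1 * (x (B j))^-1))%g
      (\prod_(j < g) [~ x (A j), x (B j)])%g.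
    elim/big_rec2: _ => [|j t w _ IH]; first exact: Ncong_refl.
    by apply: NcongM => //; exact: Ncong_commV.
  have := NcongM D_N c0 cs; rewrite rel => /(Ncong_sym D_N) c.
  have := NcongM D_N c (Ncong_refl D_N 3 (\prod_(j < g) [~ x (A j), x (B j)])^-1%g).
  by rewrite mulgK mul1g.
exists (nat * J)%type, (restored_op x0 Y sp T); split.
  by apply: elim_faithful => //; apply/eqP; rewrite eq_sym.
have XE y : y != x0 -> ~~ sp y -> restored_op x0 Y sp T y = tower_op Y y k.
  by move=> yx0 ysp; rewrite /restored_op (negPf yx0) /elim_op /= (negPf yx0) (negPf ysp) /= subn0.
rewrite big_ord_recl {1 2}/restored_op eqxx /= /elim_op /= brop_shift_lift.
rewrite (eq_bigr (fun j => brop (tower_op Y (A j) k) (tower_op Y (B j) k))).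
  by rewrite /T addNr.
by move=> j _; rewrite !XE.
Qed.

End SurfaceRelation.

Section LowerCentralLiePairs.
Local Open Scope ring_scope.
Variables (G : groupType) (D : nat -> set G) (D_N : N_series D).
Variables (I : choiceType) (x : I -> G) (J : Type) (X : I -> operator J).
Hypothesis x_gen : forall w, exists u, w = word_eval x u.

Lemma lower_central_lie_pair j w : (0 < j)%N -> lower_central j w ->
  exists t, lie_pair D (fun=> 1%N) x X j w t.
Proof.
have level1 u : exists t, lie_pair D (fun=> 1%N) x X 1 u t.
  have [l ->] := x_gen u; elim: l => [|[y b] l [t P]].
    by exists 0; rewrite /word_eval big_nil; apply: lie_pair0; exact: N_series1.
  rewrite word_eval_cons; have Py := lie_pair_letter D (fun=> 1%N) x X y.
  case: b; first by exists (- X y + t); apply: lie_pairM => //; exact: lie_pairV.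
  by exists (X y + t); exact: lie_pairM.
elim: j w => // -[_ w _ _|j IH w _]; first exact: level1.
rewrite lower_centralS //.
apply: (@subgroup_generated_ind _ _
  [set w | exists t, lie_pair D (fun=> 1%N) x X j.+2 w t]%classic).
  apply/is_subgroupP; split=> [|u v [t P] [t' P']|u [t P]].
  - by exists 0; apply: lie_pair0; exact: N_series1.
  - by exists (t + t'); exact: lie_pairM.
  - by exists (- t); exact: lie_pairV.
move=> _ [u _ [v jv <-]].
have [t' P'] := IH v isT jv; have [t P] := level1 u.
by exists (brop t t'); have := lie_pairR P P'; rewrite add1n.
Qed.

End LowerCentralLiePairs.

(** * Functionals killing the relation are spanned by symplectic chains *)

Section SymplecticChains.
Local Open Scope ring_scope.
Variable g : nat.
Local Notation I := ('I_g + 'I_g)%type.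
Implicit Types (phi psi eta xi p e : I -> rat) (u : seq I).

(** The value of phi (x) psi at sum_i (a_i b_i - b_i a_i): the symplectic form on the dual of the
    first rational homology. *)
Definition omega phi psi : rat :=
  \sum_(i < g) (phi (inl i) * psi (inr i) - phi (inr i) * psi (inl i)).

Definition dirac_fun (x : I) : I -> rat := fun y => (y == x)%:R.

Lemma omegaC phi psi : omega phi psi = - omega psi phi.
Proof. by rewrite /omega -sumrN; apply: eq_bigr => i _; ring. Qed.

Lemma omega_self phi : omega phi phi = 0.
Proof. by rewrite /omega big1 // => i _; rewrite mulrC subrr. Qed.

Lemma omega_linr e a phi psi :
  omega e (fun x => a * phi x + psi x) = a * omega e phi + omega e psi.
Proof. by rewrite /omega mulr_sumr -big_split; apply: eq_bigr => i _ /=; ring. Qed.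

Lemma omega_linl e a phi psi :
  omega (fun x => a * phi x + psi x) e = a * omega phi e + omega psi e.
Proof. by rewrite !(omegaC _ e) omega_linr opprD mulrN. Qed.

Lemma omega_scaler e a phi : omega e (fun x => a * phi x) = a * omega e phi.
Proof. by rewrite /omega mulr_sumr; apply: eq_bigr => i _ /=; ring. Qed.

Lemma omega_lin2r e a b phi psi :
  omega e (fun x => a * phi x + b * psi x) = a * omega e phi + b * omega e psi.
Proof. by rewrite omega_linr omega_scaler. Qed.

Lemma omega_scalel e a phi : omega (fun x => a * phi x) e = a * omega phi e.
Proof. by rewrite omegaC omega_scaler (omegaC phi) mulrN. Qed.

Lemma omega_dirac e (x : I) :
  omega e (dirac_fun x) = match x with inl i => - e (inr i) | inr i => e (inl i) end.
Proof.
have Ell (i j : 'I_g) : (inl j == inl i :> I) = (j == i) by apply/eqP/eqP => [[]|->].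
have Err (i j : 'I_g) : (inr j == inr i :> I) = (j == i) by apply/eqP/eqP => [[]|->].
have Elr (i j : 'I_g) : (inl j == inr i :> I) = false by apply/eqP.
have Erl (i j : 'I_g) : (inr j == inl i :> I) = false by apply/eqP.
rewrite /omega /dirac_fun; case: x => i; rewrite (bigD1 i) // big1 => [|j /negPf ji];
  by rewrite ?Ell ?Err ?Elr ?Erl ?eqxx ?ji /=; ring.
Qed.

Lemma omega_dirac_inj e e' :
  (forall x, omega e (dirac_fun x) = omega e' (dirac_fun x)) -> e = e'.
Proof.
move=> H; apply/funext => -[] i.
  by have := H (inr i); rewrite !omega_dirac.
by have := H (inl i); rewrite !omega_dirac => /oppr_inj.
Qed.

Lemma omega_sum_dirac e phi : omega e phi = \sum_x phi x * omega e (dirac_fun x).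
Proof.
rewrite big_sumType /= {1}/omega -big_split /=.
by apply: eq_bigr => i _; rewrite !omega_dirac; ring.
Qed.

Lemma omega_nondegenerate e x : e x != 0 -> exists y, omega e (dirac_fun y) != 0.
Proof.
case: x => i ei; first by exists (inr i); rewrite omega_dirac.
by exists (inl i); rewrite omega_dirac oppr_eq0.
Qed.

(** By nondegeneracy of [omega], e and e' are linearly independent exactly when one of these 2 x 2
    minors is nonzero. *)
Definition omega_minor e e' x y : rat :=
  omega e (dirac_fun x) * omega e' (dirac_fun y) - omega e (dirac_fun y) * omega e' (dirac_fun x).

Lemma omega_separate e e' x y : omega_minor e e' x y != 0 ->
  exists eta, omega e eta != 0 /\ omega eta e' = 0.
Proof.
move=> m; exists (fun z => omega e' (dirac_fun y) * dirac_fun x z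
   + - omega e' (dirac_fun x) * dirac_fun y z).
rewrite (omegaC _ e') !omega_lin2r; split; last by ring.
by apply: contraNneq m => <-; rewrite /omega_minor; apply/eqP; ring.
Qed.

Lemma omega_minor_dep e xi x : e x != 0 -> (forall y z, omega_minor e xi y z = 0) ->
  exists c, xi = fun y => c * e y.
Proof.
move=> /omega_nondegenerate[z ez] m.
exists (omega xi (dirac_fun z) / omega e (dirac_fun z)).
apply: omega_dirac_inj => y.
rewrite omega_scalel; apply: (mulfI ez).
by move: (m y z) => /subr0_eq <-; field.
Qed.

(** Two linear conditions in dimension 2g >= 4 leave a space of dimension at least 2, which the line
    spanned by p cannot contain. *)
Lemma omega_transverse (hg : (2 <= g)%N) alpha beta p x : p x != 0 ->
  exists xi, [/\ omega alpha xi = 0, omega xi beta = 0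
    & exists y z, omega_minor p xi y z != 0].
Proof.
move=> px; set n := #|{: I}|.
have n4 : (4 <= n)%N by rewrite /n card_sum card_ord; lia.
pose row_of phi : 'rV[rat]_n := \row_j phi (enum_val j).
pose A : 'M[rat]_(n, 2) :=
  \matrix_(i, j) omega (if j == ord0 then alpha else beta) (dirac_fun (enum_val i)).
have rk : (1 < \rank (kermx A))%N.
  by rewrite mxrank_ker; have := rank_leq_col A; lia.
have /row_subPn[i ki] : ~~ (kermx A <= row_of p)%MS.
  apply/negP => /mxrankS; rewrite leqNgt; apply/negP/negPn.
  exact: leq_ltn_trans (rank_leq_row _) rk.
pose r := row i (kermx A); pose xi : I -> rat := fun y => r 0 (enum_rank y).
have rA : r *m A = 0 by rewrite /r -row_mul mulmx_ker row0.
have om0 (j : 'I_2) : omega (if j == ord0 then alpha else beta) xi = 0.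
  have := congr1 (fun M : 'rV[rat]_2 => M 0 j) rA; rewrite !mxE => <-.
  rewrite omega_sum_dirac (reindex (@enum_val _ (mem {: I}))) /=.
    by apply: eq_bigr => l _; rewrite [A l j]mxE /xi enum_valK.
  by apply: onW_bij; apply: enum_val_bij.
exists xi; split.
- exact: (om0 ord0).
- by rewrite omegaC; have := om0 ord_max; rewrite /= => ->; rewrite oppr0.
apply: contrapT => no; case/negP: ki.
have [|c xiE] := @omega_minor_dep p xi x px.
  by move=> y z; apply: contrapT => m; apply: no; exists y, z; apply/eqP.
apply/sub_rVP; exists c; apply/rowP => j.
have E : xi (enum_val j) = c * p (enum_val j) by rewrite xiE.
by rewrite [RHS]mxE [X in _ = _ * X]mxE -E /xi enum_valK.
Qed.

(* [chain_val [:: phi_1; ...; phi_k]] is the functional phi_1 (x) ... (x) phi_k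
   evaluated at words of length k. *)
Fixpoint chain_val (c : seq (I -> rat)) u : rat :=
  match c, u with
  | [::], [::] => 1
  | phi :: c', x :: u' => phi x * chain_val c' u'
  | _, _ => 0
  end.

Definition head_perp e (c : seq (I -> rat)) : Prop :=
  if c is phi :: _ then omega e phi = 0 else True.

Fixpoint legal_chain (c : seq (I -> rat)) : Prop :=
  if c is phi :: c' then head_perp phi c' /\ legal_chain c' else True.

(* The functionals on words of length k killing the ideal generated by
   sum_i a_i b_i - b_i a_i. *)
Definition kills_relation k (f : seq I -> rat) : Prop :=
  forall u v, (size u + size v + 2 = k)%N ->
  \sum_(i < g) (f (u ++ [:: inl i, inr i & v]) - f (u ++ [:: inr i, inl i & v])) = 0.

(** Plain sums suffice: scalars are absorbed in a vector of the chain. Functionals are compared on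
    words of length k only. *)
Inductive chain_span (P : seq (I -> rat) -> Prop) (k : nat) : (seq I -> rat) -> Prop :=
| chain_span0 f : (forall u, size u = k -> f u = 0) -> chain_span P k f
| chain_spanS c f f' : P c -> chain_span P k f' ->
    (forall u, size u = k -> f u = chain_val c u + f' u) -> chain_span P k f.

Lemma chain_span_eq P k f f' : chain_span P k f ->
  (forall u, size u = k -> f' u = f u) -> chain_span P k f'.
Proof.
case=> [{}f f0|c {}f f1 Pc Cf E] ff'.
  by apply: chain_span0 => u uk; rewrite ff' ?f0.
by apply: (chain_spanS Pc Cf) => u uk; rewrite ff' // E.
Qed.

Lemma chain_spanD P k f f' : chain_span P k f -> chain_span P k f' ->
  chain_span P k (fun u => f u + f' u).
Proof.
move=> Cf Cf'; elim: Cf => {f} [f f0|c f f1 Pc _ IH E].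
  by apply: chain_span_eq Cf' _ => u uk; rewrite f0 ?add0r.
by apply: (chain_spanS Pc IH) => u uk; rewrite E // addrA.
Qed.

Lemma chain_span1 (P : seq (I -> rat) -> Prop) k c : P c -> chain_span P k (chain_val c).
Proof.
move=> Pc; apply: (chain_spanS Pc (@chain_span0 _ _ (fun=> 0) _)) => // u _.
by rewrite addr0.
Qed.

Lemma chain_span_sum P k (T : finType) (F : T -> seq I -> rat) :
  (forall t, chain_span P k (F t)) -> chain_span P k (fun u => \sum_t F t u).
Proof.
move=> CF; elim: (index_enum T) => [|t s IH].
  by apply: chain_span0 => u _; rewrite big_nil.
by apply: chain_span_eq (chain_spanD (CF t) IH) _ => u _; rewrite big_cons.
Qed.

Lemma chain_span_trans P P' k f : chain_span P k f ->
  (forall c, P c -> chain_span P' k (chain_val c)) -> chain_span P' k f.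
Proof.
move=> Cf PP'; elim: Cf => {f} [f f0|c f f1 Pc _ IH E]; first exact: chain_span0.
by apply: chain_span_eq (chain_spanD (PP' c Pc) IH) _ => u uk; rewrite E.
Qed.

Definition tensor e (f : seq I -> rat) : seq I -> rat :=
  fun u => if u is x :: u' then e x * f u' else 0.

Lemma chain_span_tensor P P' k e f : chain_span P k f ->
  (forall c, P c -> P' (e :: c)) -> chain_span P' k.+1 (tensor e f).
Proof.
move=> Cf PP'; elim: Cf => {f} [f f0|c f f1 Pc _ IH E].
  by apply: chain_span0 => -[|x u] //= [uk]; rewrite f0 ?mulr0.
apply: chain_span_eq (chain_spanD (chain_span1 _ (PP' c Pc)) IH) _ => -[|x u] //= [uk].
by rewrite E // mulrDr.
Qed.

Lemma chain_val_kills k c : legal_chain c -> kills_relation k (chain_val c).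
Proof.
move=> Lc u v _; elim: u c Lc => [|x u IH] [|phi c] //=.
- by move=> _; rewrite big1 // => i _; rewrite subrr.
- case: c => [|psi c] /= [ph _]; first by rewrite big1 // => i _; rewrite !mulr0 subrr.
  rewrite (eq_bigr (fun i => (phi (inl i) * psi (inr i) - phi (inr i) * psi (inl i)) * chain_val c v)).
    by rewrite -mulr_suml -/(omega phi psi) ph mul0r.
  by move=> i _; ring.
- by move=> _; rewrite big1 // => i _; rewrite subrr.
- case=> _ Lc; rewrite (eq_bigr (fun i => phi x * (chain_val c (u ++ [:: inl i, inr i & v])
      - chain_val c (u ++ [:: inr i, inl i & v])))).
    by rewrite -mulr_sumr IH // mulr0.
  by move=> i _; rewrite mulrBr.
Qed.

Lemma kills_relation_eq k f f' : kills_relation k f ->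
  (forall u, size u = k -> f' u = f u) -> kills_relation k f'.
Proof.
move=> Kf ff' u v uv; rewrite -[RHS](Kf u v uv); apply: eq_bigr => i _.
by rewrite !ff' // size_cat /= -uv; lia.
Qed.

Lemma kills_relationD k a f f' : kills_relation k f -> kills_relation k f' ->
  kills_relation k (fun u => f u + a * f' u).
Proof.
move=> Kf Kf' u v uv; have E1 := Kf u v uv; have E2 := Kf' u v uv.
rewrite (eq_bigr (fun i => (f (u ++ [:: inl i, inr i & v]) - f (u ++ [:: inr i, inl i & v]))
   + a * (f' (u ++ [:: inl i, inr i & v]) - f' (u ++ [:: inr i, inl i & v])))).
  by rewrite big_split /= -mulr_sumr E1 E2 mulr0 addr0.
by move=> i _; ring.
Qed.

Lemma chain_span_kills P k f : (forall c, P c -> legal_chain c) ->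
  chain_span P k f -> kills_relation k f.
Proof.
move=> PL; elim=> {f} [f f0|c f f1 Pc _ IH E].
  move=> u v uv; rewrite big1 // => i _.
  by rewrite !f0 ?subrr // size_cat /= -uv; lia.
apply: (kills_relation_eq (f := fun u => chain_val c u + 1 * f1 u)).
  by apply: kills_relationD IH; exact/chain_val_kills/PL.
by move=> u uk; rewrite E // mul1r.
Qed.

Definition head_transverse p (c : seq (I -> rat)) : Prop :=
  if c is phi :: _ then omega p phi <> 0 else False.

Lemma head_perp_lin a phi psi c : head_perp phi c -> head_perp psi c ->
  head_perp (fun x => a * phi x + psi x) c.
Proof.
by case: c => //= chi c E1 E2; rewrite omega_linl E1 E2 mulr0 addr0.
Qed.

Lemma head_perp_scale a phi c : head_perp phi c -> head_perp (fun x => a * phi x) c.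
Proof. by case: c => //= chi c E1; rewrite omega_scalel E1 mulr0. Qed.

Let transverse_chain p k (c : seq (I -> rat)) : Prop :=
  [/\ size c = k, legal_chain c & head_transverse p c].

(** If phi is orthogonal to p, it is split as (phi + eta) - eta: both parts pair nontrivially with p
    and remain orthogonal to the next vector. *)
Let transverse_of_eta p k phi c eta :
  legal_chain (phi :: c) -> size (phi :: c) = k ->
  omega p eta <> 0 -> head_perp eta c ->
  chain_span (transverse_chain p k) k (chain_val (phi :: c)).
Proof.
move=> [Lphi Lc] sz peta etac.
have [p0|p0] := eqVneq (omega p phi) 0; last first.
  by apply: chain_span1; split=> //; exact/eqP.
apply: (chain_spanS (c := (fun x => 1 * eta x + phi x) :: c)
    (f' := chain_val ((fun x => -1 * eta x) :: c))).
- split=> //=; last by rewrite omega_linr p0 mul1r addr0.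
  by split=> //; exact: head_perp_lin.
- apply: chain_span1; split=> //=; last by rewrite omega_scaler mulN1r => /eqP; rewrite oppr_eq0 => /eqP.
  by split=> //; exact: head_perp_scale.
- by case=> [|x u] uk //=; ring.
Qed.

(* Chains starting orthogonally to p are spread out: perturbing the first
   vector, or the second one when it is proportional to p.  The latter needs a
   vector orthogonal to two given ones and independent of p, whence g >= 2. *)
Lemma chain_span_transverse (hg : (2 <= g)%N) p x k c : p x != 0 ->
  legal_chain c -> size c = k.+1 ->
  chain_span (transverse_chain p k.+1) k.+1 (chain_val c).
Proof.
move=> px; case: c => [//|psi1 c] Lc sz.
have indep psi2 c' : (exists y z, omega_minor p psi2 y z != 0) ->
    legal_chain [:: psi1, psi2 & c'] -> size [:: psi1, psi2 & c'] = k.+1 ->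
    chain_span (transverse_chain p k.+1) k.+1 (chain_val [:: psi1, psi2 & c']).
  move=> [y [z /omega_separate[eta [/eqP peta etapsi]]]] L' sz'.
  exact: (transverse_of_eta L' sz' peta).
case: c Lc sz => [|psi2 c] Lc sz.
  have [y py] := omega_nondegenerate px.
  by apply: (transverse_of_eta (eta := dirac_fun y)) => //; exact/eqP.
have [|no] := pselect (exists y z, omega_minor p psi2 y z != 0).
  by move=> H; exact: indep.
have dep y z : omega_minor p psi2 y z = 0.
  by apply: contrapT => m; apply: no; exists y, z; exact/eqP.
have [xi [psi1xi xic [y [z m]]]] := omega_transverse hg psi1
  (if c is psi3 :: _ then psi3 else fun=> 0) px.
have xic' : head_perp xi c by case: c xic {Lc sz indep}.
have [/= L1 [L2 L3]] := Lc.
apply: (chain_span_eq (f := fun u =>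
  chain_val [:: psi1, (fun x => 1 * xi x + psi2 x) & c] u
  + chain_val [:: psi1, (fun x => -1 * xi x) & c] u)); last first.
  by move=> [|x1 [|x2 u]] //= _; rewrite ?addr0 ?mulr0 //; ring.
apply: chain_spanD; apply: indep => //=.
- exists y, z; move: (dep y z) m; rewrite /omega_minor !omega_linl => d.
  by apply: contraNneq => H; apply/eqP; rewrite -H -[LHS]addr0 -d; ring.
- split; first by rewrite omega_linr psi1xi L1 mulr0 addr0.
  by split=> //; exact: head_perp_lin.
- exists y, z; move: m; rewrite /omega_minor !omega_scalel.
  by apply: contraNneq => H; apply/eqP/oppr_inj; rewrite oppr0 -H; ring.
- split; first by rewrite omega_scaler psi1xi mulr0.
  by split=> //; exact: head_perp_scale.
Qed.

Let legal_of k e (c : seq (I -> rat)) : Prop :=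
  [/\ size c = k, legal_chain c & head_perp e c].

(** For e nonzero, [E v] is the basis vector at v projected to the hyperplane orthogonal to e, along
    a basis vector outside it. The first slot of f already lies in that hyperplane, so f is
    reproduced. *)
Let adapted_frame (e : I -> rat) (f : seq I -> rat) k :
  (forall u, size u = k -> omega e (fun x => f (x :: u)) = 0) ->
  exists E : I -> I -> rat, (forall v, omega e (E v) = 0) /\
    forall x u, size u = k -> \sum_v E v x * f (v :: u) = f (x :: u).
Proof.
move=> ef; have diracE u x : \sum_v dirac_fun v x * f (v :: u) = f (x :: u).
  rewrite (bigD1 x) //= big1 ?addr0 => [|v vx]; first by rewrite /dirac_fun eqxx mul1r.
  by rewrite /dirac_fun eq_sym (negPf vx) mul0r.
have [[x /omega_nondegenerate[y ey]]|no] := pselect (exists x, e x != 0); last first.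
  exists dirac_fun; split=> [v|x u _]; last exact: diracE.
  rewrite /omega big1 // => i _.
  have e0 z : e z = 0 by apply: contrapT => /eqP ez; apply: no; exists z.
  by rewrite !e0 !mul0r subrr.
exists (fun v z => (- (omega e (dirac_fun v) / omega e (dirac_fun y))) * dirac_fun y z + dirac_fun v z).
split=> [v|z u uk]; first by rewrite omega_linr; field.
under eq_bigr => v _ do rewrite mulrDl.
rewrite big_split /= diracE.
rewrite (eq_bigr (fun v => - (dirac_fun y z / omega e (dirac_fun y)) * (f (v :: u) * omega e (dirac_fun v)))).
  by rewrite -mulr_sumr -(omega_sum_dirac e (fun v => f (v :: u))) ef // mulr0 add0r.
by move=> v _; ring.
Qed.

(** A transverse chain starts with psi not orthogonal to p, so subtracting the multiple s p from e'
    makes e' - s p orthogonal to psi, and the chain legal. The error is p in front of s times the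
    chain. *)
Let pivot_reduction p e e' k f : omega e p = 0 -> omega e e' = 0 ->
  chain_span (transverse_chain p k) k f ->
  exists h, chain_span (fun c => size c = k /\ legal_chain c) k h /\
    chain_span (legal_of k.+1 e) k.+1 (fun u => tensor e' f u - tensor p h u).
Proof.
move=> ep ee'; elim=> {f} [f f0|c f f1 [sz Lc Tc] _ [h [Ch Cf1]] E].
  exists (fun=> 0); split; first exact: chain_span0.
  by apply: chain_span0 => -[|x u] //= [uk]; rewrite f0 // !mulr0 subrr.
case: c sz Lc Tc E => [|psi c] sz Lc //= /eqP Tc E.
pose s := omega e' psi / omega p psi.
exists (fun u => chain_val ((fun x => s * psi x) :: c) u + h u); split.
  apply: (chain_spanS (c := (fun x => s * psi x) :: c) _ Ch) => //; split=> //.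
  by case: Lc => L1 L2; split=> //; exact: head_perp_scale.
apply: (chain_spanS (c := [:: (fun x => - s * p x + e' x), psi & c]) _ Cf1).
  split=> /=; first by rewrite -sz.
    by split=> //; rewrite omega_linl /s; field.
  by rewrite omega_linr ep ee' mulr0 addr0.
case=> [|x u] /= [uk]; first by ring.
rewrite E //; case: u uk => [|x' u] uk /=; ring.
Qed.

(** Modulo legal chains, f is p (x) H for a single pivot p orthogonal to e. Then p (x) H kills the
    relation too, which says that the first slot of H is orthogonal to p; the induction hypothesis
    for H, with p in the role of e, makes p (x) H a sum of legal chains. *)
Lemma chain_span_kills_relation (hg : (2 <= g)%N) k f e : kills_relation k.+1 f ->
  (forall u, size u = k -> omega e (fun x => f (x :: u)) = 0) ->
  chain_span (legal_of k.+1 e) k.+1 f.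
Proof.
elim: k f e => [|k IH] f e Kf ef.
  apply: (chain_spanS (c := [:: fun x => f [:: x]]) (f' := fun=> 0)).
  - split=> //=; exact: ef.
  - exact: chain_span0.
  - by case=> [|x [|]] //= _; rewrite mulr1 addr0.
(* A nonzero e is its own pivot; if e = 0, every nonzero vector will do. *)
have [p [[x px] ep]] : exists p, (exists x, p x != 0) /\ omega e p = 0.
  have [H|no] := pselect (exists x, e x != 0); first by exists e; rewrite omega_self.
  pose i0 : 'I_g := Ordinal (ltn_trans (ltnSn 0) hg).
  exists (dirac_fun (inl i0)); split; first by exists (inl i0); rewrite /dirac_fun eqxx oner_eq0.
  rewrite omega_dirac; apply/eqP; rewrite oppr_eq0; apply/eqP.
  by apply: contrapT => /eqP H; apply: no; exists (inr i0).
have [E [eE fE]] := adapted_frame ef.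
have Cv v : chain_span (transverse_chain p k.+1) k.+1 (fun u => f (v :: u)).
  (* Nothing is known about the first slot of a tail of f, so the induction hypothesis is taken at
     the zero vector, where its orthogonality condition is void. *)
  apply: (@chain_span_trans (legal_of k.+1 (fun=> 0))).
    apply: IH => [u1 u2 sz|u _]; first by apply: (Kf (v :: u1)); rewrite /= -sz.
    by rewrite /omega big1 // => i _; rewrite !mul0r subrr.
  by move=> c [sz Lc _]; exact: (chain_span_transverse hg px).
have /choice[h hP] : forall v, exists h,
    chain_span (fun c => size c = k.+1 /\ legal_chain c) k.+1 h /\
    chain_span (legal_of k.+2 e) k.+2 (fun u => tensor (E v) (fun u => f (v :: u)) u - tensor p h u).
  by move=> v; exact: pivot_reduction.
pose H u := \sum_v h v u.
have CH := chain_span_sum (fun v => (hP v).1).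
have CR := chain_span_sum (fun v => (hP v).2).
set R := fun u => _ in CR.
have fR u : size u = k.+2 -> f u = R u + tensor p H u.
  case: u => [//|y u] [uk]; rewrite /R /= sumrB fE // -mulr_sumr -/(H u).
  by rewrite addrNK.
apply: (chain_span_eq (chain_spanD CR _) fR).
apply: (chain_span_tensor (P := legal_of k.+1 p)); last first.
  by move=> c [sz Lc pc]; split=> //=; rewrite sz.
apply: IH; first by apply: chain_span_kills CH => c [].
have KR : kills_relation k.+2 R by apply: chain_span_kills CR => c [].
have KT : kills_relation k.+2 (tensor p H).
  apply: kills_relation_eq (kills_relationD (-1) Kf KR) _ => u uk.
  by rewrite fR //; ring.
move=> u uk; have := KT [::] u; rewrite /= uk addn2 => /(_ erefl) <-.
by [].
Qed.

End SymplecticChains.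

(** * Unitriangular representations with a prescribed superdiagonal *)

Section Unitriangular.
Local Open Scope ring_scope.
Variables (R : comNzRingType) (n : nat).
Implicit Types (A B : 'M[R]_n.+1) (r : 'rV[R]_n.+1).

Definition unitriangular A : Prop :=
  forall i j : 'I_n.+1, (j <= i)%N -> A i j = (i == j)%:R.

Lemma unitriangular1 : unitriangular 1.
Proof. by move=> i j _; rewrite mxE. Qed.

Lemma unitriangularM A B : unitriangular A -> unitriangular B -> unitriangular (A * B).
Proof.
move=> uA uB i j ji; rewrite mxE (bigD1 i) //= uA // eqxx mul1r uB // big1 ?addr0 // => l li.
have [lt|le] := ltnP l i; first by rewrite uA ?(ltnW lt) // eq_sym (negPf li) mul0r.
have il : (i < l)%N by rewrite ltn_neqAle le andbT eq_sym (inj_eq val_inj).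
rewrite [B l j]uB ?(leq_trans ji) //.
by rewrite (_ : l == j = false) ?mulr0 //; apply/eqP => E; move: il; rewrite E; lia.
Qed.

Lemma unitriangularM_superdiag A B (i j : 'I_n.+1) : unitriangular A ->
  unitriangular B -> j = i.+1 :> nat -> (A * B) i j = A i j + B i j.
Proof.
move=> uA uB ij; have ji : j != i by apply/eqP => /(congr1 val) /=; lia.
rewrite mxE (bigD1 i) //= (bigD1 j) //= uA // eqxx mul1r (uB j j) // eqxx mulr1.
rewrite big1 ?addr0 1?addrC // => l /andP[li lj].
have [lt|le] := ltnP l i; first by rewrite uA ?(ltnW lt) // eq_sym (negPf li) mul0r.
have jl : (j < l)%N.
  rewrite ltn_neqAle eq_sym (inj_eq val_inj) lj ij ltn_neqAle le.
  by rewrite eq_sym (inj_eq val_inj) li.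
by rewrite [B l j]uB ?(ltnW jl) // (negPf lj) mulr0.
Qed.

Definition starts_at (c : nat) r : Prop := forall j : 'I_n.+1, (j < c)%N -> r 0 j = 0.

Lemma starts_atM c r A : unitriangular A -> starts_at c r -> starts_at c (r *m A).
Proof.
move=> uA rc j jc; rewrite mxE big1 // => l _.
have [lc|cl] := ltnP l c; first by rewrite rc ?mul0r.
by rewrite uA ?(ltnW (leq_trans jc cl)) // (_ : l == j = false) ?mulr0 //;
  apply/eqP => E; move: jc; rewrite -E; lia.
Qed.

Lemma starts_atD c r r' : starts_at c r -> starts_at c r' -> starts_at c (r + r').
Proof. by move=> rc rc' j jc; rewrite mxE rc // rc' // addr0. Qed.

Lemma starts_atN c r : starts_at c r -> starts_at c (- r).
Proof. by move=> rc j jc; rewrite mxE rc // oppr0. Qed.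

Lemma row_unitriangular_lead r A (j : 'I_n.+1) : unitriangular A ->
  starts_at j r -> (r *m A) 0 j = r 0 j.
Proof.
move=> uA rc; rewrite mxE (bigD1 j) //= uA // eqxx mulr1 big1 ?addr0 // => l lj.
have [lt|le] := ltnP l j; first by rewrite rc ?mul0r.
by rewrite uA // (negPf lj) mulr0.
Qed.

Lemma row_unitriangular_next r A (i j : 'I_n.+1) : unitriangular A ->
  starts_at i r -> j = i.+1 :> nat -> (r *m A) 0 j = r 0 i * A i j + r 0 j.
Proof.
move=> uA rc ij; have ji : j != i by apply/eqP => /(congr1 val) /=; lia.
rewrite mxE (bigD1 i) //= (bigD1 j) //= (uA j j) // eqxx mulr1.
rewrite big1 ?addr0 // => l /andP[li lj].
have [lt|le] := ltnP l i; first by rewrite rc // mul0r.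
have jl : (j < l)%N.
  rewrite ltn_neqAle eq_sym (inj_eq val_inj) lj ij ltn_neqAle le.
  by rewrite eq_sym (inj_eq val_inj) li.
by rewrite uA ?(ltnW jl) // (negPf lj) mulr0.
Qed.

End Unitriangular.

Section SurfaceRepresentations.
Local Open Scope ring_scope.
Variable g : nat.
Local Notation I := ('I_g + 'I_g)%type.

Definition mat_eval (R : nzRingType) n (a : I * bool -> 'M[R]_n.+1) (u : word I) : 'M[R]_n.+1 :=
  \prod_(l <- u) a l.

(** The matrices of the inverse letters are part of the data, so no matrix has to be inverted. *)
Record chain_rep (c : seq (I -> rat)) (a : I * bool -> 'M[rat]_((size c).+1)) : Prop :=
  ChainRep {
  chain_rep_inv : forall x b, a (x, b) * a (x, ~~ b) = 1;
  chain_rep_unitri : forall l, unitriangular (a l);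
  chain_rep_superdiag : forall x (i j : 'I_((size c).+1)), j = i.+1 :> nat ->
    a (x, false) i j = nth (fun=> 0) c i x;
  chain_rep_relator : mat_eval a (surface_relator g) = 1 }.

Section Cocycles.
Variables (c : seq (I -> rat)) (a : I * bool -> 'M[rat]_((size c).+1)).
Hypothesis Ra : chain_rep a.
Local Notation n := (size c).
Implicit Types (V : I -> 'rV[rat]_n.+1) (u : word I).

(** V is the first row of a block matrix (1, V; 0, a). Such matrices multiply by V(u u') = V(u)
    a(u') + V(u'), which forces -V(x) a(x^-1) at an inverse letter. *)
Definition cocycle_letter V (l : I * bool) : 'rV[rat]_n.+1 :=
  if l.2 then - (V l.1 *m a l) else V l.1.

Fixpoint cocycle V u : 'rV[rat]_n.+1 :=
  if u is l :: u' then cocycle_letter V l *m mat_eval a u' + cocycle V u' else 0.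

Lemma mat_eval_unitri u : unitriangular (mat_eval a u).
Proof.
rewrite /mat_eval; elim: u => [|l u IH]; first by rewrite big_nil; exact: unitriangular1.
by rewrite big_cons; apply: unitriangularM => //; exact: chain_rep_unitri.
Qed.

Lemma mat_eval_cat u u' : mat_eval a (u ++ u') = mat_eval a u * mat_eval a u'.
Proof. by rewrite /mat_eval big_cat. Qed.

Lemma cocycle_cat V u u' :
  cocycle V (u ++ u') = cocycle V u *m mat_eval a u' + cocycle V u'.
Proof.
elim: u => [|l u IH] /=; first by rewrite mul0mx add0r.
by rewrite IH mat_eval_cat mulmxDl mulmxA addrA.
Qed.

Lemma cocycleD V V' u : cocycle (fun x => V x + V' x) u = cocycle V u + cocycle V' u.
Proof.
elim: u => [|l u IH] /=; first by rewrite addr0.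
rewrite IH addrACA -mulmxDl; congr (_ *m _ + _).
by rewrite /cocycle_letter; case: l.2; rewrite // mulmxDl opprD.
Qed.

Lemma chain_rep_superdiagV x (i j : 'I_n.+1) : j = i.+1 :> nat ->
  a (x, true) i j = - a (x, false) i j.
Proof.
move=> ij; apply/eqP; rewrite -addr_eq0 addrC.
rewrite -(unitriangularM_superdiag (chain_rep_unitri Ra _) (chain_rep_unitri Ra _) ij).
rewrite (chain_rep_inv Ra x false) mxE (_ : i == j = false) //.
by apply/eqP => /(congr1 val) /=; lia.
Qed.

Let comm_word (x y : I) : word I := [:: (x, false); (y, false); (x, true); (y, true)].

(** In its leading column a cocycle is additive with signs, hence cancels over a commutator; in the
    next column only the leading column paired with the superdiagonal survives. Summed over the
    relator this gives [omega]. *)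
Lemma cocycle_commutator V k x y : (forall z, starts_at k (V z)) ->
  starts_at k.+1 (cocycle V (comm_word x y)) /\
  forall i j : 'I_n.+1, i = k :> nat -> j = k.+1 :> nat ->
    cocycle V (comm_word x y) 0 j =
      V x 0 i * a (y, false) i j - V y 0 i * a (x, false) i j.
Proof.
move=> Vk; have Lk l : starts_at k (cocycle_letter V l).
  rewrite /cocycle_letter; case: l.2 => //.
  by apply/starts_atN/starts_atM => //; exact: chain_rep_unitri.
have Llead (i : 'I_n.+1) l : i = k :> nat ->
    cocycle_letter V l 0 i = if l.2 then - V l.1 0 i else V l.1 0 i.
  move=> ik; rewrite /cocycle_letter; case: l.2 => //; rewrite mxE.
  by rewrite row_unitriangular_lead ?ik //; exact: chain_rep_unitri.
have Uk u := mat_eval_unitri u.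
have rowD (r r' : 'rV[rat]_n.+1) j : (r + r') 0 j = r 0 j + r' 0 j by rewrite mxE.
have row0E j : (0 : 'rV[rat]_n.+1) 0 j = 0 by rewrite mxE.
split.
  move=> j; rewrite ltnS leq_eqVlt => /orP[/eqP jk|jk]; last first.
    by rewrite /= !rowD row0E !(starts_atM (Uk _) (Lk _)) // !addr0.
  have L u l : (cocycle_letter V l *m mat_eval a u) 0 j = cocycle_letter V l 0 j.
    by rewrite row_unitriangular_lead ?jk.
  by rewrite /= !rowD row0E !L !Llead //=; ring.
move=> i j ik jk; have ij : j = i.+1 :> nat by rewrite jk ik.
have L u l : (cocycle_letter V l *m mat_eval a u) 0 j =
    (if l.2 then - V l.1 0 i else V l.1 0 i) * mat_eval a u i j + cocycle_letter V l 0 j.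
  by rewrite (row_unitriangular_next (i := i)) ?ik // (Llead i l ik).
have M l u : mat_eval a (l :: u) i j = a l i j + mat_eval a u i j.
  rewrite {1}/mat_eval big_cons unitriangularM_superdiag //; last exact: Uk.
  exact: chain_rep_unitri.
have M0 : mat_eval a [::] i j = 0.
  rewrite /mat_eval big_nil mxE (_ : i == j = false) //.
  by apply/eqP => /(congr1 val) /=; lia.
have LV z : cocycle_letter V (z, true) 0 j = - (V z 0 i * a (z, true) i j + V z 0 j).
  by rewrite {1}/cocycle_letter /= mxE (row_unitriangular_next (i := i)) ?ik //; exact: chain_rep_unitri.
rewrite /= !rowD row0E !L !M M0 !LV /= !(chain_rep_superdiagV _ ij).
rewrite /cocycle_letter /=; ring.
Qed.

Lemma cocycle_relator V k : (forall z, starts_at k (V z)) ->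
  starts_at k.+1 (cocycle V (surface_relator g)) /\
  forall i j : 'I_n.+1, i = k :> nat -> j = k.+1 :> nat ->
    cocycle V (surface_relator g) 0 j =
      omega (fun x => V x 0 i) (fun x => a (x, false) i j).
Proof.
move=> Vk.
have -> : @omega g = fun phi psi : I -> rat => \sum_(i <- enum 'I_g)
    (phi (inl i) * psi (inr i) - phi (inr i) * psi (inl i)).
  by apply/funext=> phi; apply/funext=> psi; rewrite big_enum.
have Uk u := mat_eval_unitri u.
rewrite /surface_relator; elim: (enum 'I_g) => [|z s [IH1 IH2]] /=.
  split=> [j _|i j _ _]; first by rewrite mxE.
  by rewrite big_nil mxE.
have [C1 C2] := cocycle_commutator (inl z) (inr z) Vk.
rewrite -/(comm_word (inl z) (inr z) ++ _).
set u := flatten _; have -> : cocycle_letter V (inl z, false) *m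
  mat_eval a [:: (inr z, false), (inl z, true), (inr z, true) & u] +
  (cocycle_letter V (inr z, false) *m mat_eval a [:: (inl z, true), (inr z, true) & u] +
   (cocycle_letter V (inl z, true) *m mat_eval a ((inr z, true) :: u) +
    (cocycle_letter V (inr z, true) *m mat_eval a u + cocycle V u))) =
  cocycle V (comm_word (inl z) (inr z)) *m mat_eval a u + cocycle V u.
  by rewrite -cocycle_cat.
split; first by apply: starts_atD IH1; exact: starts_atM.
move=> i j ik jk; rewrite big_cons mxE (IH2 i j ik jk) row_unitriangular_lead ?jk //.
by rewrite (C2 i j ik jk).
Qed.

(* Solves for the last row from left to right: column k+1 of the cocycle at the
   relator is corrected by changing column k, which pairs with the nonzero
   functional c_k of the superdiagonal. *)
Lemma cocycle_solution phi : head_perp phi c ->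
  (forall i, (i < n)%N -> exists x, nth (fun=> 0) c i x != 0) ->
  exists V, (forall x, V x 0 0 = phi x) /\ cocycle V (surface_relator g) = 0.
Proof.
move=> ph nz.
suff H k : exists V, (forall x, V x 0 0 = phi x) /\ starts_at k.+2 (cocycle V (surface_relator g)).
  have [V [V0 Vn]] := H n; exists V; split=> //.
  by apply/rowP => j; rewrite Vn ?mxE // ltnW // ltnS.
elim: k => [|k [V [V0 Vk]]].
  (* Column 0 is prescribed. Column 1 of the relator is then omega phi c_0, which vanishes by
     [head_perp]. *)
  exists (fun x => phi x *: delta_mx 0 0); split=> [x|].
    by rewrite !mxE !eqxx mulr1.
  have [C1 C2] := @cocycle_relator (fun x => phi x *: delta_mx 0 0) 0 (fun _ _ => ltac:(by [])).
  move=> j; rewrite ltnS leq_eqVlt => /orP[/eqP j1|/C1 //].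
  rewrite (C2 0 j) //.
  have -> : (fun x => (phi x *: (delta_mx 0 0 : 'rV[rat]_n.+1)) 0 0) = phi.
    by apply/funext => x; rewrite !mxE !eqxx mulr1.
  have -> : (fun x => a (x, false) 0 j) = nth (fun=> 0) c 0.
    by apply/funext => x; rewrite (chain_rep_superdiag Ra).
  have : (0 < n)%N by rewrite -ltnS -j1 ltn_ord.
  by case: (c) ph => // psi c' ph _ /=.
have [kn|nk] := ltnP k.+2 n.+1; last first.
  exists V; split=> // j _; apply: Vk; exact: leq_trans (ltn_ord j) nk.
pose j := Ordinal kn; pose i : 'I_n.+1 := Ordinal (ltnW kn).
pose psi x := a (x, false) i j.
have [y py] : exists y, omega (dirac_fun y) psi != 0.
  have [|x nx] := nz k.+1; first by rewrite -ltnS.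
  have [|y py] := @omega_nondegenerate g psi x.
    by rewrite /psi (chain_rep_superdiag Ra).
  by exists y; rewrite omegaC oppr_eq0.
pose s := - cocycle V (surface_relator g) 0 j / omega (dirac_fun y) psi.
pose W x : 'rV[rat]_n.+1 := (s * dirac_fun y x) *: delta_mx 0 i.
have Wk z : starts_at k.+1 (W z).
  move=> l lk; rewrite !mxE (_ : l == i = false) ?mulr0 //.
  by apply/eqP => E; move: lk; rewrite E ltnn.
have [C1 C2] := cocycle_relator Wk.
exists (fun x => V x + W x); rewrite cocycleD; split=> [x|l].
  by rewrite mxE V0 Wk // addr0.
rewrite ltnS leq_eqVlt => /orP[/eqP lk|lk]; last first.
  by rewrite mxE Vk // C1 // addr0.
have -> : l = j by apply: val_inj.
rewrite mxE (C2 i j) // -/psi.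
have -> : (fun x => W x 0 i) = (fun x => s * dirac_fun y x).
  by apply/funext => x; rewrite !mxE !eqxx mulr1.
by rewrite omega_scalel /s divfK // subrr.
Qed.

End Cocycles.

Lemma chain_rep_nil : chain_rep (c := [::]) (fun=> 1).
Proof.
split=> [x b|l|x i j|]; rewrite ?mulr1 //.
- exact: unitriangular1.
- by rewrite !ord1.
- by rewrite /mat_eval big1.
Qed.

(** A new row on top of the matrices of c: the block matrices satisfy the relator exactly when the
    cocycle of that row vanishes on it. *)
Lemma chain_rep_cons phi c (a : I * bool -> 'M[rat]_((size c).+1)) :
  chain_rep a -> head_perp phi c ->
  (forall i, (i < size c)%N -> exists x, nth (fun=> 0) c i x != 0) ->
  exists a' : I * bool -> 'M[rat]_((size (phi :: c)).+1), chain_rep a'.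
Proof.
move=> Ra ph nz; have [V [V0 Vr]] := cocycle_solution Ra ph nz.
pose a' l : 'M[rat]_(1 + (size c).+1) := block_mx 1%:M (cocycle_letter a V l) 0 (a l).
have evalE u : \prod_(l <- u) (a' l : 'M[rat]_((size c).+2)) =
    block_mx 1%:M (cocycle a V u) 0 (mat_eval a u) :> 'M[rat]_(1 + (size c).+1).
  elim: u => [|l u IH] /=.
    by rewrite big_nil /mat_eval big_nil -scalar_mx_block.
  rewrite big_cons IH /mat_eval big_cons -/(mat_eval a u).
  transitivity (a' l *m block_mx 1%:M (cocycle a V u) 0 (mat_eval a u)); first by [].
  rewrite /a' mulmx_block !mul1mx !mul0mx !mulmx0 !addr0 add0r.
  by rewrite [cocycle a V u + _]addrC.
exists a'; split.
- move=> x b; transitivity (a' (x, b) *m a' (x, ~~ b)); first by [].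
  rewrite /a' mulmx_block !mul1mx !mul0mx !mulmx0 !addr0 add0r.
  have aa := chain_rep_inv Ra x.
  have -> : a (x, b) *m a (x, ~~ b) = 1 by exact: aa.
  rewrite (_ : _ + _ = 0) -?scalar_mx_block //.
  rewrite /cocycle_letter; case: b => /=; last by rewrite addNr.
  have := aa true; rewrite -mulmxE /= => E.
  by rewrite mulNmx -mulmxA E mulmx1 subrr.
- move=> l i j; change (j <= i -> a' l (i : 'I_(1 + (size c).+1)) j = (i == j)%:R)%N.
  case: (split_ordP (i : 'I_(1 + (size c).+1))) => i' ->;
    case: (split_ordP (j : 'I_(1 + (size c).+1))) => j' -> /=; rewrite /a'.
  + by rewrite block_mxEul !ord1 mxE !eqxx.
  + by rewrite ord1.
  + rewrite block_mxEdl mxE (_ : (_ == _) = false) //.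
    by apply/eqP => /(congr1 val) /=; rewrite ord1.
  + by rewrite block_mxEdr leq_add2l => ij; rewrite (chain_rep_unitri Ra) //.
- move=> x i j.
  change (j = i.+1 :> nat -> a' (x, false) (i : 'I_(1 + (size c).+1)) j = nth (fun=> 0) (phi :: c) i x).
  case: (split_ordP (i : 'I_(1 + (size c).+1))) => i' ->;
    case: (split_ordP (j : 'I_(1 + (size c).+1))) => j' -> /=; rewrite /a'.
  + by rewrite !ord1.
  + rewrite ord1 => -[j0]; rewrite block_mxEur /cocycle_letter /= -V0.
    by congr (V x _ _); apply/val_inj.
  + by rewrite ord1.
  + by rewrite block_mxEdr => -[ij]; rewrite (chain_rep_superdiag Ra).
- rewrite /mat_eval evalE Vr (chain_rep_relator Ra).
  by rewrite -scalar_mx_block.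
Qed.

Lemma chain_rep_exists c : legal_chain c ->
  (forall i, (i < size c)%N -> exists x, nth (fun=> 0) c i x != 0) ->
  exists a : I * bool -> 'M[rat]_((size c).+1), chain_rep a.
Proof.
elim: c => [|phi c IH] /= Lc nz; first by exists (fun=> 1); exact: chain_rep_nil.
have nz' i : (i < size c)%N -> exists x, nth (fun=> 0) c i x != 0 by move=> ic; exact: (nz i.+1).
have [a Ra] := IH Lc.2 nz'.
exact: (chain_rep_cons Ra Lc.1 nz').
Qed.

End SurfaceRepresentations.

(** * Representations and the filtration by superdiagonals *)

Section UpperOrder.
Local Open Scope ring_scope.
Variables (R : comNzRingType) (n : nat).
Implicit Types (A B E F U : 'M[R]_n.+1).

Definition upper_order (k : nat) E : Prop :=
  forall i j : 'I_n.+1, (j < i + k)%N -> E i j = 0.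

Lemma upper_orderM k l E F : upper_order k E -> upper_order l F ->
  upper_order (k + l) (E * F).
Proof.
move=> Ek Fl i j ij; rewrite mxE big1 // => h _.
have [hk|kh] := ltnP h (i + k)%N; first by rewrite Ek ?mul0r.
by rewrite Fl ?mulr0 //; lia.
Qed.

Lemma upper_orderM_lead k l E F (i h j : 'I_n.+1) : upper_order k E ->
  upper_order l F -> h = (i + k)%N :> nat -> j = (h + l)%N :> nat ->
  (E * F) i j = E i h * F h j.
Proof.
move=> Ek Fl ih hj; rewrite mxE (bigD1 h) //= big1 ?addr0 // => h' hh.
have : (h' != h :> nat) by rewrite (inj_eq val_inj).
rewrite neq_ltn => /orP[lt|lt]; first by rewrite Ek ?mul0r // -ih.
by rewrite Fl ?mulr0 //; lia.
Qed.

Lemma upper_orderD k E F : upper_order k E -> upper_order k F -> upper_order k (E + F).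
Proof. by move=> Ek Fk i j ij; rewrite mxE Ek // Fk // addr0. Qed.

Lemma upper_orderN k E : upper_order k E -> upper_order k (- E).
Proof. by move=> Ek i j ij; rewrite mxE Ek // oppr0. Qed.

Lemma upper_order_le k l E : (k <= l)%N -> upper_order l E -> upper_order k E.
Proof. by move=> kl El i j ij; apply: El; exact: leq_trans ij (leq_add (leqnn _) kl). Qed.

Lemma unitriangular_order U : unitriangular U -> upper_order 0 U.
Proof.
move=> uU i j; rewrite addn0 => ij; rewrite uU ?(ltnW ij) //.
by rewrite (_ : i == j = false) //; apply/eqP => E; move: ij; rewrite E ltnn.
Qed.

Lemma unitriangular_sub1 U : unitriangular U -> upper_order 1 (U - 1).
Proof. by move=> uU i j; rewrite addn1 ltnS => ij; rewrite !mxE uU // subrr. Qed.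

Lemma unitriangularMl_lead k U E (i j : 'I_n.+1) : unitriangular U ->
  upper_order k E -> j = (i + k)%N :> nat -> (U * E) i j = E i j.
Proof.
move=> uU Ek ij; rewrite (upper_orderM_lead (h := i) (unitriangular_order uU) Ek) ?addn0 //.
by rewrite uU // eqxx mul1r.
Qed.

Lemma unitriangularMr_lead k U E (i j : 'I_n.+1) : unitriangular U ->
  upper_order k E -> j = (i + k)%N :> nat -> (E * U) i j = E i j.
Proof.
move=> uU Ek ij; rewrite (upper_orderM_lead (h := j) Ek (unitriangular_order uU)) ?addn0 //.
by rewrite uU // eqxx mulr1.
Qed.

End UpperOrder.

Section UnitriangularRepresentations.
Local Open Scope ring_scope.
Variables (G : groupType) (R : comNzRingType) (n : nat).

Record unitri_rep (rho : G -> 'M[R]_n.+1) : Prop := UnitriRep {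
  unitri_repM : forall x y, rho (x * y)%g = rho x * rho y;
  unitri_rep_unitri : forall x, unitriangular (rho x) }.

Variable rho : G -> 'M[R]_n.+1.
Hypothesis rhoP : unitri_rep rho.

(** As [rho 1] is idempotent, E = rho 1 - 1 satisfies E = -E^2; being strictly upper triangular, E
    has ever larger order, hence is 0. *)
Lemma unitri_rep1 : rho 1%g = 1.
Proof.
have e : rho 1%g * rho 1%g = rho 1%g by rewrite -(unitri_repM rhoP) mulg1.
have U1 := unitri_rep_unitri rhoP 1%g.
have ord k : upper_order k (rho 1%g - 1).
  elim: k => [|k IH].
    exact: upper_order_le (unitriangular_sub1 U1).
  case: k IH => [_|k IH]; first exact: unitriangular_sub1.
  apply: (@upper_order_le _ _ _ (k.+1 + k.+1)); first by lia.
  have -> : rho 1%g - 1 = - ((rho 1%g - 1) * (rho 1%g - 1)).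
    by rewrite mulrBl mul1r mulrBr mulr1 e subrr sub0r opprK.
  by apply: upper_orderN; exact: upper_orderM.
apply/subr0_eq/matrixP => i j; rewrite (ord n.+1) ?mxE //.
exact: ltn_addl.
Qed.

Lemma unitri_repV x : rho x^-1%g * rho x = 1.
Proof. by rewrite -(unitri_repM rhoP) mulVg unitri_rep1. Qed.

Lemma unitri_repR x y : rho [~ x, y]%g - 1 =
  rho (y * x)^-1%g * ((rho x - 1) * (rho y - 1) - (rho y - 1) * (rho x - 1)).
Proof.
have -> : ((rho x - 1) * (rho y - 1) - (rho y - 1) * (rho x - 1)) =
    rho (x * y)%g - rho (y * x)%g.
  rewrite !(unitri_repM rhoP) !mulrBl !mulrBr !mul1r !mulr1.
  set a := rho x * rho y; set b := rho y * rho x.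
  by apply/matrixP => i j; rewrite !mxE; ring.
rewrite mulrBr unitri_repV -(unitri_repM rhoP); congr (rho _ - _).
by rewrite /commg /conjg invgM !mulgA.
Qed.

Lemma lower_central_upper_order k w : (0 < k)%N -> lower_central k w ->
  upper_order k (rho w - 1).
Proof.
elim: k w => // -[_ w _ _|k IH w _].
  exact/unitriangular_sub1/(unitri_rep_unitri rhoP).
rewrite lower_centralS //.
apply: (@subgroup_generated_ind _ _ [set w | upper_order k.+2 (rho w - 1)]%classic).
  have uord x := unitriangular_order (unitri_rep_unitri rhoP x).
  apply/is_subgroupP; split=> [|u v /= ou ov|u /= ou].
  - by rewrite /= unitri_rep1 subrr => i j _; rewrite mxE.
  - have -> : rho (u * v)%g - 1 = (rho u - 1) * rho v + (rho v - 1).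
      by rewrite (unitri_repM rhoP) mulrBl mul1r addrA subrK.
    by apply: upper_orderD => //; rewrite -[k.+2]addn0; exact: upper_orderM.
  - have -> : rho u^-1%g - 1 = - (rho u^-1%g * (rho u - 1)).
      by rewrite mulrBr unitri_repV mulr1 opprB.
    by apply: upper_orderN; rewrite -[k.+2]add0n; exact: upper_orderM.
move=> _ [u _ [v kv <-]] /=; rewrite unitri_repR -[k.+2]add0n.
have ou := unitriangular_sub1 (unitri_rep_unitri rhoP u).
have ov := IH v isT kv.
apply: upper_orderM; first exact/unitriangular_order/(unitri_rep_unitri rhoP).
apply: upper_orderD; first by rewrite -add1n; exact: upper_orderM.
by apply: upper_orderN; rewrite -addn1; exact: upper_orderM.
Qed.

End UnitriangularRepresentations.

Section PresentedRepresentation.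
Local Open Scope ring_scope.
Variables (g : nat) (c : seq ('I_g + 'I_g -> rat)).
Variable a : ('I_g + 'I_g) * bool -> 'M[rat]_((size c).+1).
Hypothesis Ra : chain_rep a.

Definition rep_of (w : surface_group g) : 'M[rat]_((size c).+1) := mat_eval a (repr w).

Lemma mat_eval_pres_eq u v : pres_eq [set surface_relator g]%classic u v -> mat_eval a u = mat_eval a v.
Proof.
elim=> {u v} [//|//|u v w _ -> _ -> //|u x b v|u r v ->].
  rewrite !mat_eval_cat; congr (_ * _).
  by rewrite /mat_eval !big_cons mulrA (chain_rep_inv Ra) mul1r.
by rewrite !mat_eval_cat (chain_rep_relator Ra) mul1r.
Qed.

Lemma rep_of_word u : rep_of (\pi_(presented _)%qT u) = mat_eval a u.
Proof. exact/mat_eval_pres_eq/pres_repr. Qed.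

Lemma rep_of_unitri : unitri_rep rep_of.
Proof.
split=> [x y|x]; last exact: mat_eval_unitri.
by rewrite /rep_of -mat_eval_cat; exact: (rep_of_word (repr x ++ repr y)).
Qed.

Lemma rep_of_gen x (i j : 'I_(size c).+1) : j = i.+1 :> nat ->
  rep_of (pres_gen _ x) i j = nth (fun=> 0) c i x.
Proof.
by move=> ij; rewrite rep_of_word /mat_eval big_seq1 (chain_rep_superdiag Ra).
Qed.

End PresentedRepresentation.

(** * Expansion of group elements in signed words *)

Section SignedWords.
Local Open Scope ring_scope.
Variable I : Type.
Implicit Types (l : seq (bool * seq I)) (f : seq I -> rat).

Definition pairing l f : rat := \sum_(p <- l) (-1) ^+ p.1 * f p.2.

Definition signed_opp l : seq (bool * seq I) := [seq (~~ p.1, p.2) | p <- l].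

Definition signed_mul l l' : seq (bool * seq I) :=
  [seq (p.1 (+) q.1, p.2 ++ q.2) | p <- l, q <- l'].

Definition signed_comm l l' := signed_mul l l' ++ signed_opp (signed_mul l' l).

Lemma pairing_cons b u l f : pairing ((b, u) :: l) f = (-1) ^+ b * f u + pairing l f.
Proof. by rewrite /pairing big_cons. Qed.

Lemma pairing_cat l l' f : pairing (l ++ l') f = pairing l f + pairing l' f.
Proof. by rewrite /pairing big_cat. Qed.

Lemma pairing_opp l f : pairing (signed_opp l) f = - pairing l f.
Proof.
rewrite /pairing /signed_opp big_map -sumrN; apply: eq_bigr => -[[] u] _ /=; ring.
Qed.

Lemma pairing_mul l l' f :
  pairing (signed_mul l l') f =
  \sum_(p <- l) (-1) ^+ p.1 * pairing l' (fun u => f (p.2 ++ u)).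
Proof.
rewrite /pairing /signed_mul big_allpairs_dep; apply: eq_bigr => p _.
rewrite mulr_sumr; apply: eq_bigr => q _ /=; rewrite mulrA; congr (_ * _).
by rewrite signr_addb.
Qed.

Lemma pairing_mul_split l l' f f1 f2 k :
  all (fun p => size p.2 == k) l ->
  (forall u v, size u = k -> f (u ++ v) = f1 u * f2 v) ->
  pairing (signed_mul l l') f = pairing l f1 * pairing l' f2.
Proof.
move=> + ff; rewrite pairing_mul /pairing mulr_suml.
elim: l => [|p l IH] /=; first by rewrite !big_nil.
case/andP=> /eqP sp sl; rewrite !big_cons IH //; congr (_ + _).
rewrite -mulrA; congr (_ * _); rewrite mulr_sumr; apply: eq_bigr => q _.
by rewrite ff //; ring.
Qed.

Lemma all_size_mul k k' l l' : all (fun p => size p.2 == k) l ->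
  all (fun p => size p.2 == k') l' ->
  all (fun p => size p.2 == (k + k')%N) (signed_mul l l').
Proof.
move=> + sl'; elim: l => //= p l IH /andP[/eqP sp sl].
rewrite /signed_mul allpairs_cons all_cat -/(signed_mul l l') IH // andbT all_map.
by apply: sub_all sl' => q /= /eqP sq; rewrite size_cat sp sq.
Qed.

Lemma all_size_opp k l : all (fun p => size p.2 == k) l ->
  all (fun p => size p.2 == k) (signed_opp l).
Proof. by rewrite all_map. Qed.

End SignedWords.

Section Operators.
Local Open Scope ring_scope.
Variables (I J : Type) (X : I -> operator J).
Hypothesis XD : forall i, {morph X i : u v / u + v}.

Definition op_word (u : seq I) (v : J -> rat) : J -> rat := foldr (fun x => X x) v u.

Lemma op_word_cat u u' v : op_word (u ++ u') v = op_word u (op_word u' v).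
Proof. by rewrite /op_word foldr_cat. Qed.

Lemma op_wordD u : {morph op_word u : v w / v + w}.
Proof. by elim: u => // x u IH v w /=; rewrite IH XD. Qed.

Lemma op_word_pairing u (l : seq (bool * seq I)) (F : seq I -> J -> rat) (v : J -> rat) :
  (forall j, v j = pairing l (fun u' => F u' j)) ->
  forall j, op_word u v j = pairing l (fun u' => op_word u (F u') j).
Proof.
elim: l v => [|[b u'] l IH] v vE j.
  have -> : v = 0 by apply/funext => j'; rewrite vE /pairing big_nil.
  by rewrite additive0 ?/pairing ?big_nil //; exact: op_wordD.
pose w : J -> rat := fun j => pairing l (fun u' => F u' j).
have wE j' : w j' = pairing l (fun u' => F u' j') by [].
rewrite pairing_cons -(IH w wE).
have -> : v = (if b then - F u' else F u') + w.
  apply/funext => j'; rewrite vE pairing_cons.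
  by case: b {vE} => /=; rewrite addfE ?oppfE ?expr1 ?expr0 ?mulN1r ?mul1r.
rewrite op_wordD addfE; congr (_ + _).
case: b {vE} => /=; rewrite ?expr1 ?expr0 ?mulN1r ?mul1r // additiveN //.
exact: op_wordD.
Qed.

End Operators.

Section Expansion.
Local Open Scope ring_scope.
Variable g : nat.
Local Notation I := ('I_g + 'I_g)%type.
Local Notation Gam := (surface_group g).
Local Notation gen := (pres_gen [set surface_relator g]%classic : I -> Gam).
Variable k : nat.

Lemma chain_val_cat (c c' : seq (I -> rat)) u v : size c = size u ->
  chain_val (c ++ c') (u ++ v) = chain_val c u * chain_val c' v.
Proof.
elim: c u => [|phi c IH] [|x u] //= => [_|[cu]]; first by rewrite mul1r.
by rewrite IH // mulrA.
Qed.

Section OneRepresentation.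
Variables (c : seq (I -> rat)) (a : I * bool -> 'M[rat]_((size c).+1)).
Hypotheses (Ra : chain_rep a) (ck : size c = k).

(* The matrix of w differs from 1 first on the j-th superdiagonal, where it is
   given by evaluating the slices of the chain c at l. *)
Definition rep_expansion (j : nat) (w : Gam) (l : seq (bool * seq I)) : Prop :=
  upper_order j (rep_of a w - 1) /\
  forall s t : 'I_(size c).+1, t = (s + j)%N :> nat ->
    (rep_of a w - 1) s t = pairing l (chain_val (take j (drop s c))).

Let rhoP := rep_of_unitri Ra.

(** Truncation at k+1 is harmless: a matrix of size k+1 has no superdiagonal beyond the k-th. *)
Lemma rep_expansion0 j w : trunc_lower_central k j.+1 w -> rep_expansion j w [::].
Proof.
move=> /(lower_central_upper_order rhoP) ow.
have E (s t : 'I_(size c).+1) : (t <= s + j)%N -> (rep_of a w - 1) s t = 0.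
  move=> ts; apply: ow; first by rewrite leq_min.
  by have := ltn_ord t; rewrite {2}ck; lia.
split=> [s t st|s t st]; first by rewrite E // ltnW.
by rewrite E ?st // /pairing big_nil.
Qed.

Lemma rep_expansion_gen x : rep_expansion 1 (gen x) [:: (false, [:: x])].
Proof.
split; first exact/unitriangular_sub1/(unitri_rep_unitri rhoP).
move=> s t; rewrite addn1 => st; rewrite mxE (rep_of_gen Ra x st) !mxE.
rewrite (_ : s == t = false) ?subr0; last by apply/eqP => /(congr1 val) /=; lia.
have sc : (s < size c)%N by rewrite -ltnS -st.
by rewrite (drop_nth (fun=> 0) sc) /= take0 /pairing big_seq1 /= expr0 mul1r mulr1.
Qed.

Lemma rep_expansionM j w w' l l' : rep_expansion j w l -> rep_expansion j w' l' ->
  rep_expansion j (w * w')%g (l ++ l').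
Proof.
move=> [o1 e1] [o2 e2].
have U := unitri_rep_unitri rhoP w'.
have E : rep_of a (w * w')%g - 1 = (rep_of a w - 1) * rep_of a w' + (rep_of a w' - 1).
  by rewrite (unitri_repM rhoP) mulrBl mul1r addrA subrK.
split=> [|s t st]; rewrite E.
  by apply: upper_orderD => //; rewrite -[j]addn0; apply: upper_orderM => //; exact: unitriangular_order.
by rewrite mxE (unitriangularMr_lead U o1 st) e1 // e2 // pairing_cat.
Qed.

Lemma rep_expansionV j w l : rep_expansion j w l -> rep_expansion j w^-1%g (signed_opp l).
Proof.
move=> [o1 e1]; have U := unitri_rep_unitri rhoP w^-1%g.
have E : rep_of a w^-1%g - 1 = - (rep_of a w^-1%g * (rep_of a w - 1)).
  by rewrite mulrBr (unitri_repV rhoP) mulr1 opprB.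
split=> [|s t st]; rewrite E.
  by apply: upper_orderN; rewrite -[j]add0n; apply: upper_orderM => //; exact: unitriangular_order.
by rewrite mxE (unitriangularMl_lead U o1 st) e1 // pairing_opp.
Qed.

Lemma rep_expansionR i j w w' l l' :
  all (fun p => size p.2 == i) l -> all (fun p => size p.2 == j) l' ->
  rep_expansion i w l -> rep_expansion j w' l' ->
  rep_expansion (i + j) [~ w, w']%g (signed_comm l l').
Proof.
move=> sl sl' r1 r2; have [[o1 e1] [o2 e2]] := (r1, r2); have U := unitri_rep_unitri rhoP (w' * w)^-1%g.
have o12 := upper_orderM o1 o2; have o21 := upper_orderM o2 o1.
(* On superdiagonal i' + j' the product passes through the single index s + i', and the slice of c
   splits at the same place. *)
have lead i' j' w1 w2 l1 l2 : all (fun p => size p.2 == i') l1 ->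
    rep_expansion i' w1 l1 -> rep_expansion j' w2 l2 ->
    forall s t : 'I_(size c).+1, t = (s + (i' + j'))%N :> nat ->
    ((rep_of a w1 - 1) * (rep_of a w2 - 1)) s t =
      pairing (signed_mul l1 l2) (chain_val (take (i' + j') (drop s c))).
  move=> s1 [o1' e1'] [o2' e2'] s t st.
  have hlt : (s + i' < (size c).+1)%N by have := ltn_ord t; lia.
  pose h := Ordinal hlt.
  rewrite (upper_orderM_lead (h := h) o1' o2') //=; last by rewrite st addnA.
  rewrite e1' // e2' /= ?st ?addnA //.
  rewrite (pairing_mul_split (f1 := chain_val (take i' (drop s c)))
     (f2 := chain_val (take j' (drop (s + i') c))) _ s1) // => u v su.
  rewrite takeD drop_drop (addnC i') chain_val_cat //.
  by rewrite size_takel ?su // size_drop; have := ltn_ord t; lia.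
rewrite addnC in o21.
split=> [|s t st]; rewrite (unitri_repR rhoP).
  rewrite -[X in upper_order X]add0n; apply: upper_orderM; first exact: unitriangular_order.
  by apply: upper_orderD => //; exact: upper_orderN.
rewrite (unitriangularMl_lead U _ st); last by apply: upper_orderD => //; exact: upper_orderN.
have st' : t = (s + (j + i))%N :> nat by rewrite st; lia.
rewrite mxE (lead _ _ _ _ _ _ sl r1 r2 s t st) [X in _ + X]mxE.
rewrite (lead _ _ _ _ _ _ sl' r2 r1 s t st') (addnC j).
by rewrite /signed_comm pairing_cat pairing_opp.
Qed.

End OneRepresentation.

(** The bridge between both sides: l is the Lie polynomial expanded in the free associative ring,
    and the same l serves the operator t and all chain representations of size k+1. *)
Lemma lie_pair_expansion (J : Type) (X : I -> operator J) :
  (forall i, {morph X i : u v / u + v}) ->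
  forall j w t, lie_pair (trunc_lower_central k) (fun=> 1%N) gen X j w t ->
  exists l, [/\ all (fun p => size p.2 == j) l,
    forall v i, t v i = pairing l (fun u => op_word X u v i)
  & forall (c : seq (I -> rat)) (a : I * bool -> 'M[rat]_((size c).+1)),
      chain_rep a -> size c = k -> rep_expansion a j w l].
Proof.
move=> XD j w t.
elim=> {j w t} [j w Dw|x|j w w' t t' _ [l [s1 e1 r1]] _ [l' [s2 e2 r2]]|j w t _ [l [s1 e1 r1]]
  |i j w w' t t' _ [l [s1 e1 r1]] _ [l' [s2 e2 r2]]].
- exists [::]; split=> // [v i|c a Ra ck]; first by rewrite /pairing big_nil.
  exact: rep_expansion0.
- exists [:: (false, [:: x])]; split=> // [v i|c a Ra ck].
    by rewrite /pairing big_seq1 /= expr0 mul1r.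
  exact: rep_expansion_gen.
- exists (l ++ l'); split=> [|v i|c a Ra ck]; first by rewrite all_cat s1.
    by rewrite addopE addfE e1 e2 pairing_cat.
  by apply: rep_expansionM => //; [exact: r1 | exact: r2].
- exists (signed_opp l); split=> [|v i|c a Ra ck]; first exact: all_size_opp.
    by rewrite oppopE oppfE e1 pairing_opp.
  by apply: rep_expansionV => //; exact: r1.
- exists (signed_comm l l'); split=> [|v i'|c a Ra ck].
  + by rewrite all_cat all_size_mul // all_size_opp // addnC all_size_mul.
  + rewrite /brop addfE oppfE e1 e2 /signed_comm pairing_cat pairing_opp !pairing_mul.
    congr (_ - _); apply: eq_bigr => p _; congr (_ * _).
      rewrite (op_word_pairing XD _ (F := fun u' => op_word X u' v) (e2 v)).
      by apply: eq_bigr => q _; rewrite op_word_cat.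
    rewrite (op_word_pairing XD _ (F := fun u' => op_word X u' v) (e1 v)).
    by apply: eq_bigr => q _; rewrite op_word_cat.
  + by apply: rep_expansionR => //; [exact: r1 | exact: r2].
Qed.

End Expansion.

(** * Index of congruence kernels *)

Section CongruenceKernel.
Local Open Scope ring_scope.
Variables (G : groupType) (k : nat) (rho : G -> 'M[int]_k.+1).
Hypothesis rhoP : unitri_rep rho.

Definition congruence_kernel (m : nat) : set G :=
  [set x | forall i j, (m %| (rho x - 1) i j)%Z]%classic.

Let dvd_mulmxl m (A B : 'M[int]_k.+1) :
  (forall i j, (m %| B i j)%Z) -> forall i j, (m %| (A * B) i j)%Z.
Proof.
by move=> mB i j; rewrite mxE; apply: rpred_sum => h _; exact: dvdz_mull.
Qed.

Let dvd_mulmxr m (A B : 'M[int]_k.+1) :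
  (forall i j, (m %| A i j)%Z) -> forall i j, (m %| (A * B) i j)%Z.
Proof.
by move=> mA i j; rewrite mxE; apply: rpred_sum => h _; exact: dvdz_mulr.
Qed.

Let rho1 := unitri_rep1 rhoP.
Let rhoM := unitri_repM rhoP.

Lemma congruence_kernel_normal m : is_normal_subgroup (congruence_kernel m).
Proof.
split=> [|x y Hx].
  apply/is_subgroupP; split=> [i j|x y Hx Hy i j|x Hx i j].
  - by rewrite rho1 subrr mxE dvdz0.
  - have -> : rho (x * y)%g - 1 = (rho x - 1) * rho y + (rho y - 1).
      by rewrite rhoM mulrBl mul1r addrA subrK.
    by rewrite mxE rpredD // dvd_mulmxr.
  - have -> : rho x^-1%g - 1 = - (rho x^-1%g * (rho x - 1)).
      by rewrite mulrBr (unitri_repV rhoP) mulr1 opprB.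
    by rewrite mxE rpredN dvd_mulmxl.
move=> i j; have -> : rho (x ^ y)%g - 1 = rho y^-1%g * ((rho x - 1) * rho y).
  by rewrite mulrBl mul1r mulrBr (unitri_repV rhoP) -!rhoM.
by apply: dvd_mulmxl; exact: dvd_mulmxr.
Qed.

Lemma card_upper_pairs : #|[pred p : 'I_k.+1 * 'I_k.+1 | (p.1 < p.2)%N]| = ((k * k.+1) %/ 2)%N.
Proof.
rewrite -sum1_card -(pair_big_dep xpredT (fun i j : 'I_k.+1 => i < j)%N (fun _ _ => 1%N)) /=.
rewrite (exchange_big_dep xpredT) //=.
rewrite (eq_bigr (fun j : 'I_k.+1 => j : nat)) => [|j _].
  by rewrite -(big_mkord xpredT id) bin2_sum bin2 divn2 mulnC.
have jk : (j <= k.+1)%N by exact/ltnW.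
by rewrite -(big_ord_widen _ (fun=> 1%N) jk) sum_nat_const card_ord muln1.
Qed.

Lemma congruence_kernel_index m : (0 < m)%N ->
  exists2 h : nat, has_index (congruence_kernel m) h & (h <= m ^ ((k * k.+1) %/ 2))%N.
Proof.
case: m => // m _.
pose U := {p : 'I_k.+1 * 'I_k.+1 | (p.1 < p.2)%N}.
pose T := {ffun U -> 'I_m.+1}.
(* A coset is determined by the residues above the diagonal, the other entries being the same for
   all elements. *)
pose res (x : G) : T := [ffun u => inord `|(rho x (val u).1 (val u).2 %% m.+1)%Z|%N].
have resP x y : res x = res y <-> congruence_kernel m.+1 (x^-1 * y)%g.
  have E : rho (x^-1 * y)%g - 1 = rho x^-1%g * (rho y - rho x).
    by rewrite mulrBr (unitri_repV rhoP) -rhoM.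
  have E' : rho y - rho x = rho x * (rho (x^-1 * y)%g - 1).
    by rewrite mulrBr mulr1 -rhoM mulgA mulgV mul1g.
  have -> : congruence_kernel m.+1 (x^-1 * y)%g <->
      forall i j, (m.+1 %| (rho y - rho x) i j)%Z.
    by split=> H; [rewrite E' | rewrite /congruence_kernel /= E]; exact: dvd_mulmxl.
  split=> [xy i j|H].
    have [ij|ji] := ltnP i j; last first.
      by rewrite !mxE !(unitri_rep_unitri rhoP) // subrr dvdz0.
    have /ffunP/(_ (Sub (i, j) ij)) := xy; rewrite !ffunE /= => /(congr1 val) /=.
    rewrite !inordK; try by rewrite -ltz_nat gez0_abs ?modz_ge0 ?ltz_pmod.
    move=> e; rewrite !mxE -eqz_mod_dvd; apply/eqP.
    by move/(congr1 Posz): e; rewrite !gez0_abs ?modz_ge0.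
  apply/ffunP => -[[i j] ij]; rewrite !ffunE /=; congr (inord `|_|%N).
  by have := H i j; rewrite !mxE -eqz_mod_dvd => /eqP.
have sub : (lcosets (congruence_kernel m.+1) `<=`
    (fun t => [set y | enum_rank (res y) = t :> nat]) @` `I_#|T|)%classic.
  move=> _ [x _ <-]; exists (enum_rank (res x)); first exact: ltn_ord.
  apply/seteqP; split=> y /=.
    move=> /val_inj/enum_rank_inj/esym/resP H; exists (x^-1 * y)%g => //.
    by rewrite mulgA mulgV mul1g.
  by move=> [h Hh <-]; congr (enum_rank _ : nat); apply/esym/resP; rewrite mulgA mulVg mul1g.
have le : (lcosets (congruence_kernel m.+1) #<= `I_#|T|)%card.
  exact: card_le_trans (subset_card_le sub) (card_image_le _ _).
have /finite_setP[h hh] : finite_set (lcosets (congruence_kernel m.+1)).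
  by apply/finite_set_leP; exists #|T|.
exists h => //; rewrite -card_upper_pairs.
have <- : #|T| = (m.+1 ^ #|[pred p : 'I_k.+1 * 'I_k.+1 | (p.1 < p.2)%N]|)%N.
  by rewrite card_ffun card_ord card_sig.
by rewrite -card_le_II; apply: card_le_trans le; move: hh; rewrite card_eq_le => /andP[].
Qed.

End CongruenceKernel.

(** * A logarithmic modulus, and polynomial growth of matrix entries *)

Section SmallNondivisor.
Local Open Scope ring_scope.

Lemma leq_wexp2r (m n e : nat) : (m <= n)%N -> (m ^ e <= n ^ e)%N.
Proof. by case: e => // e mn; rewrite leq_exp2r. Qed.

(** If all m up to log_2 N + 2 divided N, then N would be at least 2^(log_2 N + 1) with the
    logarithm rounded down, which exceeds N. *)
Lemma small_nondivisor (N : nat) : (0 < N)%N ->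
  exists m, [/\ (0 < m)%N, (m <= (trunc_log 2 N).+2)%N & ~~ (m %| N)%N].
Proof.
move=> N0; apply: contrapT => no.
have : (2 ^ (trunc_log 2 N).+1 <= N)%N.
  apply: exp2_leq_of_dvdn => // m /andP[m0 mN].
  by apply: contrapT => mdiv; apply: no; exists m; split=> //; exact/negP.
by rewrite leqNgt trunc_log_ltn.
Qed.

(** From N <= ((1+K) n)^k. The additive constants 2 and ln (1+K) are absorbed using 1 <= ln n / ln
    2, whence the nested divisions by ln 2. *)
Lemma trunc_log_ln_bound (R : realType) (N K k n : nat) : (0 < N)%N -> (2 <= n)%N ->
  (N <= (1 + K * n) ^ k)%N ->
  (trunc_log 2 N).+2%:R <=
    (2 / ln 2 + k%:R / ln 2 * (ln (1 + K)%:R / ln 2 + 1)) * ln (n%:R : R).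
Proof.
move=> N0 n2 Nk.
have l2 : 0 < ln (2 : R) by apply: ln_gt0; rewrite ltr1n.
have ln2n : ln (2 : R) <= ln n%:R.
  by rewrite ler_ln ?posrE ?ltr0n ?ler_nat //; lia.
have lK : 0 <= ln ((1 + K)%:R : R) by apply: ln_ge0; rewrite ler1n.
have NK : (2 ^ trunc_log 2 N <= ((1 + K) * n) ^ k)%N.
  apply: leq_trans (trunc_logP _ N0) _ => //; apply: leq_trans Nk _.
  by apply: leq_wexp2r; nia.
have : ln (2 : R) *+ trunc_log 2 N <= (ln (1 + K)%:R + ln n%:R) *+ k.
  have n0 : 0 < (n%:R : R) by rewrite ltr0n; lia.
  have K0 : 0 < ((1 + K)%:R : R) by rewrite ltr0n.
  rewrite -lnM ?posrE // -!lnXn ?mulr_gt0 //.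
  rewrite ler_ln ?posrE ?exprn_gt0 ?mulr_gt0 //.
  by rewrite -natrM -!natrX ler_nat.
rewrite -[ln 2 *+ _]mulr_natr -[(_ + _) *+ k]mulr_natr => H.
have {}H : (trunc_log 2 N)%:R <= (ln (1 + K)%:R + ln n%:R) * k%:R / ln (2 : R).
  by rewrite ler_pdivlMr // mulrC.
have e2 : 2 <= 2 / ln 2 * ln (n%:R : R).
  by rewrite mulrAC ler_pdivlMr // ler_pM2l.
have eK : ln (1 + K)%:R <= ln (1 + K)%:R / ln 2 * ln (n%:R : R).
  by rewrite mulrAC ler_pdivlMr // ler_wpM2l.
have -> : (trunc_log 2 N).+2%:R = (trunc_log 2 N)%:R + 2 :> R by rewrite -addn2 natrD.
have : (ln (1 + K)%:R + ln n%:R) * k%:R / ln (2 : R)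
   <= k%:R / ln 2 * (ln (1 + K)%:R / ln 2 + 1) * ln (n%:R : R).
  rewrite -[X in _ <= X]mulrA -mulrA mulrC; apply: ler_wpM2l.
    by rewrite divr_ge0 ?ler0n // ltW.
  by rewrite mulrDl mul1r lerD2r.
by lra.
Qed.

End SmallNondivisor.

Section EntryGrowth.
Local Open Scope ring_scope.
Variables (G : groupType) (k : nat) (rho : G -> 'M[int]_k.+1).
Hypothesis rhoP : unitri_rep rho.
Variable S : seq G.

Lemma absz_sum (T : Type) (r : seq T) (P : pred T) (F : T -> int) :
  (`|(\sum_(i <- r | P i) F i)%R| <= \sum_(i <- r | P i) `|F i|)%N.
Proof.
apply: (big_ind2 (fun (z : int) (n : nat) => `|z| <= n)%N) => // z n z' n' zn zn'.
by apply: leq_trans (leq_add zn zn'); lia.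
Qed.

Let c0 : nat := (\sum_(y <- S) \sum_i \sum_j (`|rho y i j| + `|rho y^-1%g i j|))%N.

Let c0P y i j : y \in S \/ y^-1%g \in S -> (`|rho y i j| <= c0)%N.
Proof.
have le z : z \in S -> (`|rho z i j| + `|rho z^-1%g i j| <= c0)%N.
  move=> zS; rewrite /c0 (big_rem z zS) /= (bigD1 i) //= (bigD1 j) //=.
  by rewrite -!addnA leq_add2l leq_addr.
case=> [/le|/le]; first by apply: leq_trans; exact: leq_addr.
by rewrite invgK; apply: leq_trans; exact: leq_addl.
Qed.

Lemma entry_growth : exists K, forall s, is_word_in S s ->
  forall i j, (`|rho (\prod_(y <- s) y)%g i j| <= (1 + K * size s) ^ (j - i))%N.
Proof.
exists (k.+1 * c0)%N; elim=> [|y s IH] sS i j.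
  by rewrite big_nil (unitri_rep1 rhoP) mxE muln0 exp1n; case: (i == j).
have sS' : is_word_in S s by move=> z zs; apply: sS; rewrite in_cons zs orbT.
have {}IH := IH sS'.
have [ij|ji] := ltnP i j; last first.
  by rewrite (unitri_rep_unitri rhoP) //; move: ji; rewrite /leq => /eqP ->; case: (i == j).
rewrite big_cons (unitri_repM rhoP) mxE.
set w := (\prod_(z <- s) z)%g in IH *; set X := (1 + k.+1 * c0 * size s)%N in IH.
have [r rE] : exists r, (j - i)%N = r.+1 by exists (j - i).-1; rewrite prednK // subn_gt0.
have -> : (1 + k.+1 * c0 * size (y :: s) = X + k.+1 * c0)%N by rewrite /X /= mulnS; lia.
(* With b = (k+1) c0: the diagonal entry of the new generator contributes X^(r+1), the others at
   most b X^r since they lead closer to the diagonal, and (X + b) X^r <= (X + b)^(r+1). *)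
rewrite rE; apply: (@leq_trans (X ^ r.+1 + k.+1 * c0 * X ^ r)%N); last first.
  by rewrite expnS -mulnDl expnS leq_mul // leq_wexp2r // leq_addr.
apply: leq_trans (absz_sum _ _ _) _; rewrite (bigD1 i) //=.
have iy := unitri_rep_unitri rhoP y (leqnn i).
rewrite iy eqxx mul1r; apply: leq_add; first by rewrite -rE; exact: IH.
apply: (@leq_trans (\sum_(h < k.+1) c0 * X ^ r)%N); last first.
  by rewrite sum_nat_const card_ord mulnA.
rewrite big_mkcond /=; apply: leq_sum => h _; case: ifP => // hi.
have [ih|hi'] := ltnP i h; last first.
  by rewrite (unitri_rep_unitri rhoP) // eq_sym (negPf hi) mul0r.
rewrite abszM; apply: leq_mul; first by apply: c0P; apply: sS; rewrite mem_head.
apply: leq_trans (IH h j) _; apply: leq_pexp2l => //.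
by rewrite -ltnS -rE ltn_sub2l.
Qed.

End EntryGrowth.

(** * Separation by one representation *)

Section SeparatingKernel.
Local Open Scope ring_scope.

Definition separated_within (G : groupType) (R : realType) (e : nat) (C : R) (w : G) (n : nat) : Prop :=
  exists H : set G, [/\ is_normal_subgroup H,
    exists2 m : nat, has_index H m & m%:R <= C * ln (n%:R : R) ^+ e & ~ H w].

Lemma integral_rep_separates (R : realType) (G : groupType) (S : seq G) (k : nat)
    (rho : G -> 'M[int]_k.+1) : (0 < k)%N -> unitri_rep rho ->
  exists2 C : R, 0 <= C & forall w n, (2 <= n)%N -> has_word_length S w n ->
    rho w 0 ord_max != 0 -> separated_within ((k * k.+1) %/ 2) C w n.
Proof.
move=> k0 rhoP.
have [K KP] := entry_growth rhoP S.
set C1 : R := 2 / ln 2 + k%:R / ln 2 * (ln (1 + K)%:R / ln 2 + 1).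
have C10 : 0 <= C1.
  have l2 : 0 < ln (2 : R) by apply: ln_gt0; rewrite ltr1n.
  have lK : 0 <= ln ((1 + K)%:R : R) by apply: ln_ge0; rewrite ler1n.
  by rewrite /C1 !(addr_ge0, mulr_ge0) ?invr_ge0 ?ler0n ?ler01 ?(ltW l2).
exists (C1 ^+ ((k * k.+1) %/ 2)); first exact: exprn_ge0.
move=> w n n2 [[s [sS ws sn]] _] w0.
have N0 : (0 < `|rho w 0%R ord_max|)%N by rewrite absz_gt0.
have Nk : (`|rho w 0%R ord_max| <= (1 + K * n) ^ k)%N.
  by have := KP s sS 0 ord_max; rewrite -ws sn /= subn0.
have [m [m0 mle mN]] := small_nondivisor N0.
have [h hh hle] := congruence_kernel_index rhoP m0.
exists (congruence_kernel rho m); split.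
- exact: congruence_kernel_normal.
- exists h => //; apply: (@le_trans _ _ ((m ^ ((k * k.+1) %/ 2))%N%:R)); first by rewrite ler_nat.
  rewrite natrX -exprMn; apply: lerXn2r; rewrite ?nnegrE ?ler0n //.
    by rewrite mulr_ge0 // ln_ge0 // ler1n; lia.
  by apply: le_trans (trunc_log_ln_bound _ N0 n2 Nk); rewrite ler_nat.
- move=> /(_ 0 ord_max); rewrite !mxE (_ : 0 == ord_max = false) ?subr0.
    by rewrite /dvdz /=; exact/negP.
  by apply/eqP => /(congr1 val) /=; lia.
Qed.

(* Conjugation by the diagonal matrix with entries N^i clears denominators. *)
Lemma rational_rep_integral (G : groupType) (S : seq G) (k : nat)
    (rho : G -> 'M[rat]_k.+1) : generating S -> unitri_rep rho ->
  exists2 rhoZ : G -> 'M[int]_k.+1, unitri_rep rhoZ &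
    forall w, rho w 0 ord_max != 0 -> rhoZ w 0 ord_max != 0.
Proof.
move=> genS rhoP.
have [N N0 NP] : exists2 N : nat, (0 < N)%N & forall y i j, y \in S \/ y^-1%g \in S ->
    N%:R * rho y i j \is a Num.int.
  pose den (q : rat) := `|denq q|%N.
  pose Ny y := (\prod_i \prod_j (den (rho y i j) * den (rho y^-1%g i j)))%N.
  have den_gt0 q : (0 < den q)%N by rewrite absz_gt0 denq_neq0.
  have Ny0 y : (0 < Ny y)%N.
    by rewrite prodn_gt0 // => i; rewrite prodn_gt0 // => j; rewrite muln_gt0 !den_gt0.
  have dvd_int q M : (den q %| M)%N -> M%:R * q \is a Num.int.
    move=> /dvdnP[a ->]; rewrite natrM -mulrA rpredM ?rpred_nat //.
    have -> : (den q)%:R * q = (numq q)%:~R.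
      rewrite -{2}[q]divq_num_den pmulrn /den gez0_abs ?(ltW (denq_gt0 q)) //.
      by rewrite mulrCA divff ?mulr1 // intr_eq0 denq_neq0.
    exact: intr_int.
  have Nydvd y i j : (den (rho y i j) %| Ny y)%N /\ (den (rho y^-1%g i j) %| Ny y)%N.
    rewrite /Ny (bigD1 i) //= (bigD1 j) //= -!mulnA.
    by split; [exact: dvdn_mulr | rewrite mulnCA; exact: dvdn_mulr].
  exists (\prod_(y <- S) Ny y)%N; first exact: prodn_gt0.
  move=> y i j yS; apply: dvd_int.
  have le z : z \in S -> (Ny z %| \prod_(y <- S) Ny y)%N.
    by move=> zS; rewrite (big_rem z zS) /=; exact: dvdn_mulr.
  case: yS => /le; first by apply: dvdn_trans; case: (Nydvd y i j).
  by apply: dvdn_trans; case: (Nydvd y^-1%g i j) => _; rewrite invgK.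
(* Truncated subtraction does no harm, as entries below the diagonal vanish. Above it at least one
   factor N is present, enough to clear the denominators of a generator or its inverse. *)
pose M w : 'M[rat]_k.+1 := \matrix_(i, j) (N%:R ^+ (j - i) * rho w i j).
have MM x y : M (x * y)%g = M x * M y.
  apply/matrixP => i j; rewrite !mxE (unitri_repM rhoP) mxE mulr_sumr.
  apply: eq_bigr => h _; rewrite !mxE.
  have [hi|ih] := ltnP h i.
    rewrite (unitri_rep_unitri rhoP) ?(ltnW hi) // (_ : i == h = false) ?mul0r ?mulr0 ?mul0r //.
    by apply/eqP => E; move: hi; rewrite E ltnn.
  have [jh|hj] := ltnP j h.
    rewrite (unitri_rep_unitri rhoP y) ?(ltnW jh) // (_ : h == j = false) ?mulr0 //.
    by apply/eqP => E; move: jh; rewrite E ltnn.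
  have -> : (j - i = (h - i) + (j - h))%N by lia.
  by rewrite exprD; ring.
have MU w : unitriangular (M w).
  move=> i j ji; rewrite mxE (unitri_rep_unitri rhoP) //.
  by move: ji; rewrite /leq => /eqP ->; rewrite mul1r.
have MZ w i j : M w i j \is a Num.int.
  have [s sS ->] := genS w; elim: s sS i j => [_ i j|y s IH sS i j].
    by rewrite big_nil mxE (unitri_rep1 rhoP) mxE rpredM ?rpredX ?rpred_nat.
  rewrite big_cons MM mxE rpred_sum // => h _; apply: rpredM; last first.
    by apply: IH => z zs; apply: sS; rewrite in_cons zs orbT.
  have [le|lt] := leqP h i; first by rewrite MU // rpred_nat.
  rewrite mxE; have -> : (h - i = (h - i).-1.+1)%N by rewrite prednK // subn_gt0.
  rewrite exprS -mulrA mulrCA; apply: rpredM; first by apply: rpredX; exact: rpred_nat.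
  by apply: NP; apply: sS; rewrite mem_head.
pose rhoZ w : 'M[int]_k.+1 := \matrix_(i, j) numq (M w i j).
have rhoZE w : map_mx (intr : int -> rat) (rhoZ w) = M w.
  by apply/matrixP => i j; rewrite [LHS]mxE [X in X%:~R]mxE numqK.
exists rhoZ; last first.
  move=> w w0; rewrite mxE numq_eq0 mxE mulf_neq0 //.
  by rewrite expf_neq0 // pnatr_eq0 -lt0n.
split=> [x y|x i j ij].
  have E : map_mx (intr : int -> rat) (rhoZ (x * y)%g) = map_mx intr (rhoZ x * rhoZ y).
    by rewrite map_mxM !rhoZE MM.
  apply/matrixP => i j; apply: (@intr_inj rat).
  by have := congr1 (fun A : 'M[rat]_k.+1 => A i j) E; rewrite mxE [RHS]mxE.
by rewrite mxE MU //; case: eqP.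
Qed.

End SeparatingKernel.

(** * Finitely many chains, and the conclusion *)

Section FiniteSpanning.
Local Open Scope ring_scope.

(** A finite family from F of maximal rank spans F, since adjoining any further element of F cannot
    raise the rank. *)
Lemma finite_spanning (K : fieldType) (T : finType) (F : set (T -> K)) :
  exists n (L : 'I_n -> T -> K), (forall i, F (L i)) /\
    forall f, F f -> exists q : 'I_n -> K, forall t, f t = \sum_i q i * L i t.
Proof.
pose mat n (L : 'I_n -> T -> K) : 'M[K]_(n, #|T|) := \matrix_(i, j) L i (enum_val j).
pose P r := `[< exists n (L : 'I_n -> T -> K), (forall i, F (L i)) /\ \rank (mat n L) = r >].
have exP : exists r, P r.
  exists 0%N; apply/asboolP; exists 0%N, (fun i : 'I_0 => match i with Ordinal _ _ => fun=> 0 end).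
  split=> [[] //|]; apply/eqP; rewrite -leqn0; exact: rank_leq_row.
have ubP r : P r -> (r <= #|T|)%N.
  by move=> /asboolP[n [L [_ <-]]]; exact: rank_leq_col.
case: (ex_maxnP exP ubP) => r /asboolP[n [L [FL rL]]] rmax.
exists n, L; split=> // f Ff.
pose L' (i : 'I_n.+1) := if unlift ord0 i is Some i' then L i' else f.
have LL' : (mat n L <= mat n.+1 L')%MS.
  apply/row_subP => i; suff -> : row i (mat n L) = row (lift ord0 i) (mat n.+1 L') by exact: row_sub.
  by apply/rowP => j; rewrite !mxE /L' liftK.
have : (mat n.+1 L' <= mat n L)%MS.
  rewrite -(mxrank_leqif_sup LL').2 eqn_leq mxrankS //= rL.
  apply: rmax; apply/asboolP; exists n.+1, L'; split=> // i.
  by rewrite /L'; case: unlift.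
move=> /row_subP/(_ ord0)/submxP[q qE]; exists (fun i => q 0 i) => t.
have := congr1 (fun M : 'rV[K]_#|T| => M 0 (enum_rank t)) qE.
rewrite /L' !mxE unlift_none enum_rankK => ->.
by apply: eq_bigr => i _; rewrite mxE enum_rankK.
Qed.

End FiniteSpanning.

Section Conclusion.
Local Open Scope ring_scope.

Lemma pairing_eq (I : Type) k (l : seq (bool * seq I)) f f' :
  all (fun p => size p.2 == k) l -> (forall u, size u = k -> f u = f' u) ->
  pairing l f = pairing l f'.
Proof.
move=> + ff; elim: l => [|[b u] l IH] /=; first by rewrite /pairing !big_nil.
by case/andP=> /eqP su sl; rewrite !pairing_cons ff // IH.
Qed.

Lemma pairing_lin (I : Type) n (l : seq (bool * seq I)) (q : 'I_n -> rat) F :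
  pairing l (fun u => \sum_i q i * F i u) = \sum_i q i * pairing l (F i).
Proof.
elim: l => [|[b u] l IH].
  by rewrite /pairing big_nil big1 // => i _; rewrite big_nil mulr0.
rewrite pairing_cons IH mulr_sumr -big_split /=; apply: eq_bigr => i _.
by rewrite pairing_cons mulrDr; congr (_ + _); rewrite mulrCA.
Qed.

Variable g : nat.
Local Notation I := ('I_g + 'I_g)%type.
Local Notation Gam := (surface_group g).

(** The constant may not depend on w, so the detecting chain must come from a list fixed in advance.
    Chain functionals on words of length k live in a finite-dimensional space, and what a spanning
    family misses is missed by all. *)
Lemma finitely_many_chains k : exists r (L : 'I_r -> seq (I -> rat)),
  (forall i, size (L i) = k /\ legal_chain (L i)) /\
  forall l c, all (fun p => size p.2 == k) l -> size c = k -> legal_chain c ->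
    pairing l (chain_val c) != 0 -> exists i, pairing l (chain_val (L i)) != 0.
Proof.
pose F : set (k.-tuple I -> rat) := fun f =>
  exists c, [/\ size c = k, legal_chain c & forall u : k.-tuple I, f u = chain_val c u].
have [r [L0 [FL0 span]]] := finite_spanning F.
have /choice[L LP] : forall i, exists c,
    [/\ size c = k, legal_chain c & forall u : k.-tuple I, L0 i u = chain_val c u] by [].
exists r, L; split=> [i|l c sl sc Lc]; first by case: (LP i).
have [|q qE] := span (fun u => chain_val c u); first by exists c.
rewrite (pairing_eq (f' := fun u => \sum_i q i * chain_val (L i) u) sl) => [|u su].
  rewrite pairing_lin => H; apply: contrapT => no; case/negP: H.
  rewrite big1 // => i _; have [->|ne] := eqVneq (pairing l (chain_val (L i))) 0.
    by rewrite mulr0.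
  by case: no; exists i.
have := qE (@Tuple _ _ u (introT eqP su)); rewrite /= => ->.
by apply: eq_bigr => i _; case: (LP i) => _ _ ->.
Qed.

Lemma chain_separates (R : realType) (S : seq Gam) (c : seq (I -> rat)) k :
  generating S -> size c = k -> (0 < k)%N -> legal_chain c ->
  exists2 C : R, 0 <= C & forall w n l, (2 <= n)%N -> has_word_length S w n ->
    (forall a : I * bool -> 'M[rat]_((size c).+1), chain_rep a -> rep_expansion a k w l) ->
    pairing l (chain_val c) != 0 -> separated_within ((k * k.+1) %/ 2) C w n.
Proof.
move=> genS <- c0 Lc.
have [nz|no] := pselect (forall i, (i < size c)%N -> exists x, nth (fun=> 0) c i x != 0); last first.
  (* A chain with a zero term is the zero functional, so the assumption on the pairing cannot hold
     and any constant will do. *)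
  exists 0 => // w n l _ _ _; suff -> : pairing l (chain_val c) = 0 by rewrite eqxx.
  rewrite /pairing big1 // => -[b u] _ /=.
  suff -> : chain_val c u = 0 by rewrite mulr0.
  elim: c no u {c0 Lc} => [|phi c IH] no [|x u] //=; first by case: no.
  have [no'|nz'] := pselect (forall i, (i < size c)%N -> exists x, nth (fun=> 0) c i x != 0); last first.
    by rewrite IH ?mulr0.
  have [->|px] := eqVneq (phi x) 0; first by rewrite mul0r.
  by case: no => -[_|i ic]; [exists x | exact: no'].
have [a Ra] := chain_rep_exists Lc nz.
have [rhoZ rhoZP nzZ] := rational_rep_integral genS (rep_of_unitri Ra).
have [C C0 CP] := integral_rep_separates R S c0 rhoZP.
exists C => // w n l n2 wn ex pl; apply: CP => //; apply: nzZ.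
(* At the corner the slice of c is all of c. *)
have [_ /(_ 0 ord_max)] := ex a Ra; rewrite drop0 take_size => /(_ erefl).
rewrite mxE => E; move: pl; rewrite -E !mxE (_ : 0 == ord_max = false) ?subr0 //.
by apply/eqP => /(congr1 val) /=; lia.
Qed.

Lemma kills_relation_op_word (J : Type) (X : I -> operator J) k v (j : J) :
  (forall i, {morph X i : u v / u + v}) ->
  \sum_(i < g) brop (X (inl i)) (X (inr i)) = 0 ->
  kills_relation k (fun u => op_word X u v j).
Proof.
move=> XD rel u u' _; rewrite -[RHS](_ : op_word X u ((\sum_(i < g) brop (X (inl i)) (X (inr i))) (op_word X u' v)) j = 0).
  elim/big_rec2: _ => [|i y t _ ->]; first by rewrite zeroopE additive0 //; exact: op_wordD.
  rewrite addopE op_wordD // addfE; congr (_ + _).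
  by rewrite !op_word_cat /brop /= (additiveB (op_wordD XD u)).
by rewrite rel zeroopE additive0 //; exact: op_wordD.
Qed.

Lemma chain_span_pairing (P : seq (I -> rat) -> Prop) k f l : chain_span P k f ->
  all (fun p => size p.2 == k) l -> pairing l f != 0 ->
  exists2 c, P c & pairing l (chain_val c) != 0.
Proof.
move=> Cf sl; elim: Cf => {f} [f f0|c f f1 Pc _ IH E].
  rewrite (pairing_eq (f' := fun=> 0) sl) // /pairing big1 ?eqxx // => p _.
  by rewrite mulr0.
have [c0|c0] := eqVneq (pairing l (chain_val c)) 0; last by exists c.
rewrite (pairing_eq (f' := fun u => chain_val c u + f1 u) sl) // => H; apply: IH.
suff <- : pairing l (fun u => chain_val c u + f1 u) = pairing l f1 by [].
rewrite -[RHS]add0r -c0 /pairing -big_split /=.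
by apply: eq_bigr => p _; rewrite mulrDr.
Qed.

End Conclusion.
Local Open Scope ring_scope.

Theorem theorem6p22 (R : realType) (g : nat) (hg : (2 <= g)%N)
    (S : seq (surface_group g)) (hS : generating S) (k : nat) (hk : (1 <= k)%N) :
  exists C : R, forall (w : surface_group g) (n : nat),
    (2 <= n)%N -> has_word_length S w n -> at_level k w ->
    exists H : set (surface_group g),
      [/\ is_normal_subgroup H,
          exists2 m : nat, has_index H m &
            m%:R <= C * ln (n%:R : R) ^+ ((k * k.+1) %/ 2)
        & ~ H w].
Proof.
have [r [L [LP Lspan]]] := finitely_many_chains g k.
have /choice[C CP] : forall i : 'I_r, exists C : R, 0 <= C /\ forall w n l, (2 <= n)%N ->
    has_word_length S w n ->
    (forall a : ('I_g + 'I_g) * bool -> 'M[rat]_((size (L i)).+1), chain_rep a -> rep_expansion a k w l) ->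
    pairing l (chain_val (L i)) != 0 -> separated_within ((k * k.+1) %/ 2) C w n.
  move=> i; have [sL LL] := LP i.
  by have [C C0 CP] := chain_separates R hS sL hk LL; exists C.
(* The [C i] are nonnegative, so their sum dominates the constant of whichever chain detects w. *)
exists (\sum_i C i) => w n n2 wn [wk wk1].
suff [i [H [nH [m hm mle] Hw]]] : exists i, separated_within ((k * k.+1) %/ 2) (C i) w n.
  exists H; split=> //; exists m => //; apply: le_trans mle _.
  apply: ler_wpM2r; first by rewrite exprn_ge0 // ln_ge0 // ler1n; lia.
  by rewrite (bigD1 i) //= lerDl sumr_ge0 // => j _; case: (CP j).
have DN := trunc_lower_central_N (surface_group g) k.
have Dstop j v : trunc_lower_central (G := surface_group g) k k.+1 v -> trunc_lower_central k j v.
  by apply: lower_central_le; rewrite minnn geq_minr.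
pose gen : 'I_g + 'I_g -> surface_group g := pres_gen [set surface_relator g]%classic.
have rel : word_eval gen (surface_relator g) = 1%g by exact: word_eval_relator.
have [J [X [[XD XF] Xrel]]] := surface_faithful DN Dstop hk (ltnW hg) rel.
have genP v : exists u, v = word_eval gen u.
  have [u ->] := pres_elim v; exists u; exact/esym/word_eval_pres_gen.
have [t tP] := lower_central_lie_pair DN X genP hk wk.
have [l [sl tl expl]] := lie_pair_expansion XD tP.
(* Otherwise t = 0 and faithfulness would put w in gamma_(k+1), against its level. *)
have [v [j tvj]] : exists v j, t v j != 0.
  apply: contrapT => no; apply: wk1.
  have : trunc_lower_central k k.+1 w.
    apply: XF tP _; apply/funext => v; apply/funext => j.
    by apply: contrapT => /eqP tvj; apply: no; exists v, j.
  by rewrite /trunc_lower_central minnn.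
pose f u := op_word X u v j.
have Kf : kills_relation k f by exact: kills_relation_op_word.
have [k' kE] : exists k', k = k'.+1 by exists k.-1; rewrite prednK.
(* At the zero vector the condition on the first slot of f is void. *)
have Cf : chain_span (fun c => [/\ size c = k, legal_chain c & head_perp (fun=> 0) c]) k f.
  rewrite kE in Kf *; apply: chain_span_kills_relation => // u _.
  by rewrite /omega big1 // => i _; rewrite !mul0r subrr.
rewrite tl in tvj.
have [c [sc Lc _] pc] := chain_span_pairing Cf sl tvj.
have [i pi] := Lspan l c sl sc Lc pc.
exists i; have [_ CPi] := CP i; apply: (CPi w n l) => // a Ra.
exact: expl (LP i).1.
Qed.
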